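(* Let $\Gamma$ be a discrete group and $\Delta\subseteq\Gamma$ a positivity domain. Then the colimit of the diagram $\big((\mathrm{SOS}(\Sigma))_{\Sigma\in\mathcal{S}(\Delta)},(\iota_{2,1})_{\Sigma_1\le_\Delta\Sigma_2}\big)$ in the category of operator systems with unital completely positive maps exists and coincides with $\mathrm{UOS}(\Delta)$ (with the canonical maps $\mathrm{SOS}(\Sigma)\to\mathrm{UOS}(\Delta)$, $\delta_\gamma\mapsto\delta_\gamma$).
   Context: A positivity domain is a subset $\Delta\subseteq\Gamma$ with $e\in\Delta$ and $\Delta^{-1}=\Delta$. $\mathrm{C}^*(\Gamma)$ is the universal group C$^*$-algebra with canonical unitaries $\delta_s$; for $D\subseteq\Gamma$, $\mathrm{S}[D]=\mathrm{span}\{\delta_s\mid s\in D\}$ with $\delta_s^*=\delta_{s^{-1}}$ (when $D=D^{-1}$). An operator system is a $*$-vector space with a compatible family of proper spanning cones $\mathrm{M}_n(V)^+\subseteq \mathrm{M}_n(V)_{\mathrm h}$ ($\alpha \mathrm{M}_m(V)^+\alpha^*\subseteq \mathrm{M}_n(V)^+$ for $\alpha\in \mathrm{M}_{n,m}(\mathbb{C})$) and an Archimedean matrix order unit; a matrix order unit space is the same without the Archimedean requirement. ''ucp'' means unital completely positive. For a finite non-empty $\Sigma\subseteq\Gamma$, $\mathcal{Q}_n(\Sigma)=\{\sum_{i=1}^r y_iy_i^*\mid r\in\mathbb{N},\ y_i=\sum_{s\in\Sigma}A^i_s\otimes\delta_s,\ A^i_s\in \mathrm{M}_n(\mathbb{C})\}$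 and $\mathrm{SOS}(\Sigma)$ is the operator system $(\mathrm{S}[\Sigma\Sigma^{-1}],(\mathcal{Q}_n(\Sigma))_n,\delta_e)$. $\mathcal{S}(\Delta)$ is the family of finite non-empty subsets $\Sigma\subseteq\Gamma$ with $\Sigma\Sigma^{-1}\subseteq\Delta$. For $\Sigma_1,\Sigma_2\in\mathcal{S}(\Delta)$ write $\Sigma_1\le_\Delta\Sigma_2$ if $\Sigma_1\Sigma_1^{-1}\subseteq\Sigma_2\Sigma_2^{-1}$ and the canonical inclusion $\iota_{2,1}:\mathrm{SOS}(\Sigma_1)\to\mathrm{SOS}(\Sigma_2)$, $\delta_{st^{-1}}\mapsto\delta_{st^{-1}}$, is ucp. $\mathrm{UOS}_0(\Delta)$ is the matrix order unit space $(\mathrm{S}[\Delta],(\mathcal{U}_n(\Delta))_n,\delta_e)$, where $\mathcal{U}_n(\Delta)\subseteq \mathrm{M}_n(\mathrm{S}[\Delta])_{\mathrm h}$ is the convex cone generated by the union of the $\mathcal{Q}_n(\Sigma)$, $\Sigma\in\mathcal{S}(\Delta)$. $\mathrm{UOS}(\Delta)=\mathrm{Arch}(\mathrm{UOS}_0(\Delta))$ is its Archimedeanisation: for a matrix order unit space $X$ with unit $e_X$, let $N=\bigcap\{\ker\phi\mid\phi\text{ a state on }X\}$; $\mathrm{Arch}(X)$ is $X/N$ with unit $e_X+N$ and $n$-th cone $\{x+\mathrm{M}_n(N)\mid r(e_X)_n+x+\mathrm{M}_n(N)\in \mathrm{M}_n(X)^++\mathrm{M}_n(N)\ \forall r>0\}$,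 where $(e_X)_n=\mathrm{diag}(e_X,\dots,e_X)$. (For $\mathrm{UOS}_0(\Delta)$ one has $N=\{0\}$.) A colimit of a diagram $((X_\alpha),(\phi_{\beta,\alpha})_{\alpha\le\beta})$ is an object $X$ with morphisms $\phi_{\infty,\alpha}:X_\alpha\to X$ satisfying $\phi_{\infty,\beta}\circ\phi_{\beta,\alpha}=\phi_{\infty,\alpha}$ for $\alpha\le\beta$, such that for every object $Y$ and morphisms $\psi_{\infty,\alpha}:X_\alpha\to Y$ with $\psi_{\infty,\beta}\circ\phi_{\beta,\alpha}=\psi_{\infty,\alpha}$ there is a unique morphism $\psi:X\to Y$ with $\psi\circ\phi_{\infty,\alpha}=\psi_{\infty,\alpha}$ for all $\alpha$. *)

(* Defs.v *)
From HB Require Import structures.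
From mathcomp Require Import all_boot all_order all_algebra.
From mathcomp Require Import generic_quotient ring_quotient finmap complex.
From mathcomp Require Import all_classical all_reals all_analysis.
Set Implicit Arguments.
Unset Strict Implicit.
Unset Printing Implicit Defensive.
Import Order.TTheory GRing.Theory Num.Theory numFieldNormedType.Exports.
Local Open Scope classical_set_scope.
Local Open Scope complex_scope.
Local Open Scope ring_scope.

HB.mixin Record hasStar (R : realType) V of GRing.Lmodule R[i] V := {
  star : V -> V;
  starK : involutive star;
  star_conj_linear : forall (a : R[i]) (x y : V),
    star (a *: x + y) = a^* *: star x + star y }.

#[short(type="starLmodType")]
HB.structure Definition StarLmodule (R : realType) :=
  {V of hasStar R V & GRing.Lmodule R[i] V}.

Section StarMatrix.
Variable (R : realType).
Local Notation C := R[i].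

Section Ops.
Variable V : starLmodType R.

Lemma starD (x y : V) : star (x + y) = star x + star y.
Proof. by rewrite -[x in LHS]scale1r star_conj_linear rmorph1 scale1r. Qed.

Lemma star0 : star (0 : V) = 0.
Proof. by apply: (addrI (star 0)); rewrite -starD !addr0. Qed.

Lemma starZ (a : C) (x : V) : star (a *: x) = a^* *: star x.
Proof. by rewrite -[_ *: _ in LHS]addr0 star_conj_linear star0 addr0. Qed.

Lemma starN (x : V) : star (- x) = - star x.
Proof. by apply: (addrI (star x)); rewrite -starD !subrr star0. Qed.

Lemma star_sum I (r : seq I) (P : pred I) (F : I -> V) :
  star (\sum_(i <- r | P i) F i) = \sum_(i <- r | P i) star (F i).
Proof. exact: (big_morph _ starD star0). Qed.

Definition mxstar m n (X : 'M[V]_(m, n)) : 'M[V]_(n, m) :=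
  \matrix_(i, j) star (X j i).

Definition hermitian_mx n (X : 'M[V]_n) : Prop := mxstar X = X.

(* 'M[V]_n carries no scaling in the library, as V is not a ring. *)
Definition mxscale m n (a : C) (X : 'M[V]_(m, n)) : 'M[V]_(m, n) :=
  map_mx ( *:%R a) X.

(* alpha X alpha^*, for alpha a rectangular complex matrix *)
Definition mxcompress n m (alpha : 'M[C]_(n, m)) (X : 'M[V]_m) : 'M[V]_n :=
  \matrix_(i, j) \sum_k \sum_l (alpha i k * (alpha j l)^*) *: X k l.

(* diag(e, ..., e) *)
Definition mxdiag_const n (e : V) : 'M[V]_n := \matrix_(i, j) (e *+ (i == j)).

Definition convex_cone n (K : set 'M[V]_n) : Prop :=
  [/\ K 0,
      forall x y, K x -> K y -> K (x + y) &
      forall (r : R) x, 0 <= r -> K x -> K (mxscale r%:C x)].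

Lemma mxstarD m n (X Y : 'M[V]_(m, n)) : mxstar (X + Y) = mxstar X + mxstar Y.
Proof. by apply/matrixP => i j; rewrite !mxE starD. Qed.

Lemma mxstar0 m n : mxstar (0 : 'M[V]_(m, n)) = 0.
Proof. by apply/matrixP => i j; rewrite !mxE star0. Qed.

Lemma mxstarN m n (X : 'M[V]_(m, n)) : mxstar (- X) = - mxstar X.
Proof. by apply/matrixP => i j; rewrite !mxE starN. Qed.

Lemma mxstarZr m n (r : R) (X : 'M[V]_(m, n)) :
  mxstar (mxscale r%:C X) = mxscale r%:C (mxstar X).
Proof. by apply/matrixP => i j; rewrite !mxE starZ conj_Creal ?complex_real. Qed.

Lemma hermitian_mxdiag_const n (e : V) :
  star e = e -> hermitian_mx (mxdiag_const n e).
Proof.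
move=> he; apply/matrixP => i j; rewrite !mxE eq_sym.
by case: (i == j); rewrite ?mulr1n ?mulr0n ?star0.
Qed.

End Ops.

(* No axiom beyond hermitianity is bundled, so that the cones and the unit   *)
(* can be written down before the axioms are known to hold. Size n = 0 is    *)
(* included; there the axioms below merely say that the cone is {0}.         *)
Record mouData := MouData {
  mou_sort :> starLmodType R;
  mou_pos : forall n, set 'M[mou_sort]_n;
  mou_unit : mou_sort;
  mou_pos_hermitian : forall n x, mou_pos (n := n) x -> hermitian_mx x;
  mou_unit_hermitian : star mou_unit = mou_unit }.

Definition mou_unit_mx (X : mouData) n : 'M[X]_n := mxdiag_const n (mou_unit X).

Record is_matrix_order_unit_space (X : mouData) : Prop := {
  mou_cone : forall n, convex_cone (@mou_pos X n);
  mou_proper : forall n (x : 'M[X]_n), mou_pos x -> mou_pos (- x) -> x = 0;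
  mou_spanning : forall n (x : 'M[X]_n), hermitian_mx x ->
    exists y z, [/\ mou_pos y, mou_pos z & x = y - z];
  mou_compatible : forall m n (alpha : 'M[C]_(n, m)) (x : 'M[X]_m),
    mou_pos x -> mou_pos (mxcompress alpha x);
  mou_order_unit : forall n (x : 'M[X]_n), hermitian_mx x ->
    exists2 r : R, 0 < r & mou_pos (mxscale r%:C (mou_unit_mx X n) + x) }.

Definition is_archimedean (X : mouData) : Prop :=
  forall n (x : 'M[X]_n), hermitian_mx x ->
    (forall r : R, 0 < r -> mou_pos (mxscale r%:C (mou_unit_mx X n) + x)) ->
    mou_pos x.

Definition is_operator_system (X : mouData) : Prop :=
  is_matrix_order_unit_space X /\ is_archimedean X.

Definition ucp (X Y : mouData) (f : X -> Y) : Prop :=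
  [/\ linear f,
      f (mou_unit X) = mou_unit Y &
      forall n (x : 'M[X]_n), mou_pos x -> mou_pos (map_mx f x)].

Section Colimit.
Variables (I : Type) (le : I -> I -> Prop) (X : I -> mouData).
Variable phi : forall a b, le a b -> X a -> X b.

Definition is_opsys_diagram : Prop :=
  [/\ (forall a, le a a) /\ (forall a b c, le a b -> le b c -> le a c),
      forall a, is_operator_system (X a),
      forall a b (h : le a b), ucp (phi h),
      forall a (h : le a a) x, phi h x = x &
      forall a b c (hab : le a b) (hbc : le b c) (hac : le a c) x,
        phi hbc (phi hab x) = phi hac x].

Definition is_opsys_cocone (Y : mouData) (psi : forall a, X a -> Y) : Prop :=
  [/\ is_operator_system Y,
      forall a, ucp (psi a) &
      forall a b (h : le a b) x, psi b (phi h x) = psi a x].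

Definition is_opsys_colimit (L : mouData) (phiL : forall a, X a -> L) : Prop :=
  is_opsys_cocone phiL /\
  forall (Y : mouData) (psi : forall a, X a -> Y), is_opsys_cocone psi ->
    exists! f : L -> Y, ucp f /\ forall a x, f (phiL a x) = psi a x.

End Colimit.

Section Archimedeanisation.
Variable X : mouData.

Definition is_state (f : {scalar X}) : Prop :=
  f (mou_unit X) = 1 /\
  forall x : X, mou_pos (const_mx x : 'M[X]_1) -> 0 <= f x.

Definition null_pred : {pred X} :=
  [pred x : X | `[< forall f : {scalar X}, is_state f -> f x = 0 >]].

Lemma null_predP x :
  reflect (forall f : {scalar X}, is_state f -> f x = 0) (x \in null_pred).
Proof. exact: asboolP. Qed.

Lemma null_zmod_closed : zmod_closed null_pred.
Proof.
split=> [|x y /null_predP hx /null_predP hy]; apply/null_predP => f hf.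
  by rewrite raddf0.
by rewrite raddfB /= hx // hy // subrr.
Qed.

HB.instance Definition _ :=
  GRing.isZmodClosed.Build X null_pred null_zmod_closed.

Lemma null_scale (a : C) x : x \in null_pred -> a *: x \in null_pred.
Proof.
by move=> /null_predP hx; apply/null_predP => f hf; rewrite linearZ /= hx ?mulr0.
Qed.

Lemma null_star x : x \in null_pred -> star x \in null_pred.
Proof.
move=> /null_predP hx; apply/null_predP => f [f1 fpos].
pose g (y : X) : C := (f (star y))^*.
have g_lin : scalar g.
  by move=> a y z; rewrite /g starD starZ linearD linearZ /= rmorphD rmorphM /= conjCK.
pose G : {scalar X} := HB.pack g (GRing.isLinear.Build C X C _ g g_lin).
have /hx : is_state G.
  split=> [|y hy]; first by rewrite /= /g mou_unit_hermitian f1 rmorph1.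
  have := mou_pos_hermitian hy.
  move=> /matrixP /(_ ord0 ord0); rewrite !mxE => sy.
  by rewrite /= /g sy conjC_ge0 fpos.
by rewrite /= /g => /eqP; rewrite conjC_eq0 => /eqP.
Qed.

Definition arch_quot := Quotient.quot null_pred.
Definition arch_proj (x : X) : arch_quot := \pi_(Quotient.quot null_pred)%qT x.

HB.instance Definition _ := GRing.Zmodule.on arch_quot.

Lemma arch_projP x y : (arch_proj x = arch_proj y) <-> (x - y \in null_pred).
Proof.
rewrite /arch_proj; split=> [/eqP|] h; first by rewrite Quotient.idealrBE.
by apply/eqP; rewrite -Quotient.idealrBE.
Qed.

Lemma arch_proj_repr (q : arch_quot) : arch_proj (repr q) = q.
Proof. exact: reprK. Qed.

Lemma arch_projD x y : arch_proj (x + y) = arch_proj x + arch_proj y.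
Proof. exact: raddfD. Qed.

Definition arch_scale (a : C) (q : arch_quot) : arch_quot :=
  arch_proj (a *: repr q).

Lemma arch_scaleE a x : arch_scale a (arch_proj x) = arch_proj (a *: x).
Proof.
apply/arch_projP; rewrite -scalerBr null_scale //.
by apply/arch_projP; rewrite arch_proj_repr.
Qed.

Lemma arch_scaleA a b q : arch_scale a (arch_scale b q) = arch_scale (a * b) q.
Proof. by rewrite -(arch_proj_repr q) !arch_scaleE scalerA. Qed.

Lemma arch_scale1 : left_id 1 arch_scale.
Proof. by move=> q; rewrite -(arch_proj_repr q) arch_scaleE scale1r. Qed.

Lemma arch_scaleDr : right_distributive arch_scale +%R.
Proof.
move=> a p q; rewrite -(arch_proj_repr p) -(arch_proj_repr q).
by rewrite -arch_projD !arch_scaleE scalerDr arch_projD.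
Qed.

Lemma arch_scaleDl q : {morph arch_scale^~ q : a b / a + b}.
Proof.
move=> a b /=; rewrite -(arch_proj_repr q).
by rewrite !arch_scaleE scalerDl arch_projD.
Qed.

HB.instance Definition _ := GRing.Zmodule_isLmodule.Build C arch_quot
  arch_scaleA arch_scale1 arch_scaleDr arch_scaleDl.

Lemma arch_proj_is_linear : linear arch_proj.
Proof. by move=> a x y; rewrite arch_projD -arch_scaleE. Qed.

HB.instance Definition _ :=
  GRing.isLinear.Build C X arch_quot _ arch_proj arch_proj_is_linear.

Definition arch_star (q : arch_quot) : arch_quot := arch_proj (star (repr q)).

Lemma arch_starE x : arch_star (arch_proj x) = arch_proj (star x).
Proof.
apply/arch_projP; rewrite -starN -starD null_star //.
by apply/arch_projP; rewrite arch_proj_repr.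
Qed.

Lemma arch_starK : involutive arch_star.
Proof. by move=> q; rewrite -(arch_proj_repr q) !arch_starE starK. Qed.

Lemma arch_star_conj_linear a p q :
  arch_star (a *: p + q) = a^* *: arch_star p + arch_star q.
Proof.
rewrite -(arch_proj_repr p) -(arch_proj_repr q) -linearP !arch_starE.
by rewrite star_conj_linear linearP.
Qed.

HB.instance Definition _ :=
  hasStar.Build R arch_quot arch_starK arch_star_conj_linear.

Definition arch_pos n : set 'M[arch_quot]_n :=
  [set map_mx arch_proj x | x in
    [set x | forall r : R, 0 < r ->
      [set map_mx arch_proj p | p in @mou_pos X n]
        (map_mx arch_proj (mxscale r%:C (mou_unit_mx X n) + x))]].

Lemma mxstar_arch_proj n (x : 'M[X]_n) :
  mxstar (map_mx arch_proj x) = map_mx arch_proj (mxstar x).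
Proof. by apply/matrixP => i j; rewrite !mxE -arch_starE. Qed.

Lemma arch_pos_hermitian n x : @arch_pos n x -> hermitian_mx x.
Proof.
move=> [y /(_ 1 ltr01)[p /mou_pos_hermitian hp] hpy <-].
have -> : map_mx arch_proj y =
    map_mx arch_proj (p - mxscale 1%:C (mou_unit_mx X n)).
  by rewrite map_mxB hpy map_mxD addrC addKr.
rewrite /hermitian_mx mxstar_arch_proj mxstarD mxstarN mxstarZr hp.
by rewrite hermitian_mxdiag_const // mou_unit_hermitian.
Qed.

Lemma arch_unit_hermitian :
  star (arch_proj (mou_unit X)) = arch_proj (mou_unit X).
Proof. by rewrite [LHS]arch_starE mou_unit_hermitian. Qed.

Definition arch : mouData :=
  MouData arch_pos_hermitian arch_unit_hermitian.

End Archimedeanisation.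
End StarMatrix.

(* The norm is a field of its own because no library structure can combine   *)
(* normedModType with a ring structure: the join is already taken by         *)
(* numDomainType.                                                            *)
HB.mixin Record isCStar (R : realType) A of GRing.Algebra R[i] A & hasStar R A := {
  starM : forall x y : A, star (x * y) = star y * star x;
  cnorm : A -> R;
  cnorm_eq0 : forall x : A, cnorm x = 0 -> x = 0;
  cnormD : forall x y : A, cnorm (x + y) <= cnorm x + cnorm y;
  cnormZ : forall (a : R[i]) (x : A), (cnorm (a *: x))%:C = `|a| * (cnorm x)%:C;
  cnormM : forall x y : A, cnorm (x * y) <= cnorm x * cnorm y;
  cnorm_cstar : forall x : A, cnorm (star x * x) = cnorm x ^+ 2;
  cnorm_complete : forall u : nat -> A,
    (forall e : R, 0 < e -> exists N : nat, forall m n : nat, (N <= m)%N -> (N <= n)%N ->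
      cnorm (u m - u n) < e) ->
    exists l : A, forall e : R, 0 < e -> exists N : nat, forall n : nat, (N <= n)%N ->
      cnorm (u n - l) < e }.

#[short(type="cstarAlgType")]
HB.structure Definition CStarAlgebra (R : realType) :=
  {A of isCStar R A & GRing.Algebra R[i] A & hasStar R A}.

HB.mixin Record isHilbert (R : realType) H of CompleteNormedModule R[i] H := {
  inner : H -> H -> R[i];
  inner_linear : forall (a : R[i]) (x y z : H),
    inner (a *: x + y) z = a * inner x z + inner y z;
  inner_conj : forall x y : H, inner y x = (inner x y)^*;
  inner_norm : forall x : H, inner x x = `|x| ^+ 2 }.

#[short(type="hilbertType")]
HB.structure Definition Hilbert (R : realType) :=
  {H of isHilbert R H & CompleteNormedModule R[i] H}.

Section GroupCStar.
Variables (R : realType) (G : groupType).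
Local Notation C := R[i].

Definition unitary_rep (H : hilbertType R) (u : G -> H -> H) : Prop :=
  [/\ forall s, linear (u s),
      forall x, u 1%g x = x,
      forall s t x, u (s * t)%g x = u s (u t x) &
      forall s x y, inner (u s x) (u s y) = inner x y].

(* rho is a unital *-homomorphism from A to the bounded operators on H;      *)
(* srep_star says that rho (star a) is the adjoint of rho a.                 *)
Record is_star_rep (A : cstarAlgType R) (H : hilbertType R)
    (rho : A -> H -> H) : Prop := {
  srep_linear : forall a, linear (rho a);
  srep_continuous : forall a, continuous (rho a);
  srep_alg_linear : forall (c : C) a b x, rho (c *: a + b) x = c *: rho a x + rho b x;
  srep_one : forall x, rho 1 x = x;
  srep_mul : forall a b x, rho (a * b) x = rho a (rho b x);
  srep_star : forall a x y, inner (rho a x) y = inner x (rho (star a) y) }.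

Definition in_span (A : cstarAlgType R) (delta : G -> A) (D : set G) (x : A) :
    Prop :=
  exists2 l : seq (C * G), (forall p, p \in l -> D p.2) &
    x = \sum_(p <- l) p.1 *: delta p.2.

(* C^*(G) is characterised by: it is generated, as a C*-algebra, by the      *)
(* unitaries delta s, and every unitary representation of G on a Hilbert     *)
(* space extends to it.                                                      *)
Record groupCstar := GroupCstar {
  gc_alg :> cstarAlgType R;
  delta : G -> gc_alg;
  delta1 : delta 1%g = 1;
  deltaM : forall s t, delta (s * t)%g = delta s * delta t;
  delta_unitary : forall s,
    star (delta s) * delta s = 1 /\ delta s * star (delta s) = 1;
  delta_dense : forall (x : gc_alg) (e : R), 0 < e ->
    exists2 y, in_span delta setT y & cnorm (x - y) < e;
  delta_universal : forall (H : hilbertType R) (u : G -> H -> H),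
    unitary_rep u ->
    exists2 rho : gc_alg -> H -> H,
      is_star_rep rho & forall s x, rho (delta s) x = u s x }.

Lemma star_delta (A : groupCstar) s : star (delta A s) = delta A s^-1%g.
Proof.
have [h _] := delta_unitary A s.
rewrite -[LHS]mulr1 -(delta1 A) -(mulgV s) deltaM mulrA h.
by rewrite mul1r.
Qed.

Record posDomain := PosDomain {
  pd_set :> set G;
  pd_one : pd_set 1%g;
  pd_inv : [set s^-1%g | s in pd_set] = pd_set }.

Lemma posDomainV (D : posDomain) s : pd_set D s -> pd_set D s^-1%g.
Proof. by move=> Ds; rewrite -(pd_inv D); exists s. Qed.

End GroupCStar.

Section Span.
Variables (R : realType) (G : groupType) (A : groupCstar R G).
Local Notation C := R[i].

Section OneDomain.
Variable D : posDomain G.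

Definition span_pred : {pred A} := [pred x : A | `[< in_span (delta A) D x >]].

Lemma span_predP x : reflect (in_span (delta A) D x) (x \in span_pred).
Proof. exact: asboolP. Qed.

Lemma span_submod_closed : submod_closed span_pred.
Proof.
split=> [|a x y /span_predP[l hl ->] /span_predP[m hm ->]]; apply/span_predP.
  by exists [::]; rewrite ?big_nil.
exists ([seq (a * p.1, p.2) | p <- l] ++ m) => [p|].
  by rewrite mem_cat => /orP[/mapP[q /hl ? ->]|/hm].
rewrite big_cat big_map /= scaler_sumr; congr (_ + _).
by apply: eq_bigr => p _; rewrite scalerA.
Qed.

HB.instance Definition _ :=
  GRing.isSubmodClosed.Build C A span_pred span_submod_closed.

Lemma span_star x : x \in span_pred -> star x \in span_pred.
Proof.
move=> /span_predP[l hl ->]; apply/span_predP.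
exists [seq (p.1^*, p.2^-1%g) | p <- l] => [p|].
  by move=> /mapP[q /hl Dq ->]; exact: posDomainV.
rewrite star_sum big_map; apply: eq_bigr => p _ /=.
by rewrite starZ star_delta.
Qed.

Lemma delta_span s : pd_set D s -> delta A s \in span_pred.
Proof.
move=> Ds; apply/span_predP; exists [:: (1, s)].
  by move=> p; rewrite inE => /eqP ->.
by rewrite big_seq1 /= scale1r.
Qed.

(* S[D] as a subspace of C^*(G). *)
Record spanS := SpanS { span_val : A; span_valP : span_val \in span_pred }.

HB.instance Definition _ := [isSub of spanS for span_val].
HB.instance Definition _ := [Choice of spanS by <:].
HB.instance Definition _ := [SubChoice_isSubLmodule of spanS by <:].

Definition spanS_star (x : spanS) : spanS := SpanS (span_star (span_valP x)).

Lemma spanS_starK : involutive spanS_star.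
Proof. by move=> x; apply: val_inj => /=; rewrite starK. Qed.

Lemma spanS_star_conj_linear a x y :
  spanS_star (a *: x + y) = a^* *: spanS_star x + spanS_star y.
Proof. by apply: val_inj => /=; rewrite star_conj_linear. Qed.

HB.instance Definition _ :=
  hasStar.Build R spanS spanS_starK spanS_star_conj_linear.

Definition spanS_unit : spanS := SpanS (delta_span (pd_one D)).

Lemma spanS_unit_hermitian : star spanS_unit = spanS_unit.
Proof. by apply: val_inj => /=; rewrite star_delta invg1. Qed.

Lemma spanS_hermitian n (X : 'M[spanS]_n) :
  hermitian_mx (map_mx span_val X) -> hermitian_mx X.
Proof.
move=> /matrixP h; apply/matrixP => i j; apply: val_inj.
by have := h i j; rewrite !mxE.
Qed.

End OneDomain.

Lemma span_mono (D1 D2 : posDomain G) x :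
  D1 `<=` D2 -> x \in span_pred D1 -> x \in span_pred D2.
Proof.
by move=> h /span_predP[l hl ->]; apply/span_predP; exists l => // p /hl /h.
Qed.

Definition span_incl (D1 D2 : posDomain G) (h : D1 `<=` D2) (x : spanS D1) :
  spanS D2 := SpanS (span_mono h (span_valP x)).

Definition tensor n (M : 'M[C]_n) (a : A) : 'M[A]_n :=
  map_mx (fun c => c *: a) M.

Definition sos_factor n (E : {fset G}) (B : G -> 'M[C]_n) : 'M[A]_n :=
  \sum_(s <- E) tensor (B s) (delta A s).

Definition sos_cone n (E : {fset G}) : set 'M[A]_n :=
  [set M | exists (r : nat) (B : 'I_r -> G -> 'M[C]_n),
    M = \sum_(i < r) sos_factor E (B i) *m mxstar (sos_factor E (B i))].

Lemma sos_cone_hermitian n E (M : 'M[A]_n) : sos_cone E M -> hermitian_mx M.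
Proof.
move=> [r [B ->]]; apply/matrixP => i j; rewrite !mxE !summxE star_sum.
apply: eq_bigr => k _; rewrite !mxE star_sum; apply: eq_bigr => l _.
by rewrite !mxE starM starK.
Qed.

Definition finNonempty := {E : {fset G} | E != fset0}.

(* E E^-1 *)
Definition ratio_set (E : {fset G}) : set G :=
  [set (s * t^-1)%g | s in [set` E] & t in [set` E]].

Lemma ratio_set1 (E : finNonempty) : ratio_set (val E) 1%g.
Proof.
by have [s sE] := fset0Pn _ (valP E); exists s => //; exists s; rewrite ?mulgV.
Qed.

Lemma ratio_setV (E : {fset G}) :
  [set s^-1%g | s in ratio_set E] = ratio_set E.
Proof.
apply/seteqP; split=> [_ [_ [s sE [t tE <-]] <-]|_ [s sE [t tE <-]]].
  by exists t => //; exists s => //; rewrite invgM invgK.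
exists (t * s^-1)%g; first by exists t => //; exists s.
by rewrite invgM invgK.
Qed.

Definition ratio_domain (E : finNonempty) : posDomain G :=
  PosDomain (ratio_set1 E) (ratio_setV (val E)).

Definition SOS_pos (E : finNonempty) n : set 'M[spanS (ratio_domain E)]_n :=
  [set X | sos_cone (val E) (map_mx (@span_val _) X)].

Lemma SOS_pos_hermitian E n X : @SOS_pos E n X -> hermitian_mx X.
Proof. by move=> /sos_cone_hermitian /spanS_hermitian. Qed.

Definition SOS (E : finNonempty) : mouData R :=
  MouData (@SOS_pos_hermitian E) (spanS_unit_hermitian (ratio_domain E)).

Section FixDelta.
Variable D : posDomain G.

Definition S_family := {E : finNonempty | `[< ratio_domain E `<=` D >]}.

Lemma S_familyP (E : S_family) : ratio_domain (val E) `<=` D.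
Proof. exact/asboolP/(valP E). Qed.

Definition SOS_family (E : S_family) : mouData R := SOS (val E).

Definition S_le (E1 E2 : S_family) : Prop :=
  exists h : ratio_domain (val E1) `<=` ratio_domain (val E2),
    ucp (span_incl h : SOS_family E1 -> SOS_family E2).

Lemma S_le_sub E1 E2 :
  S_le E1 E2 -> ratio_domain (val E1) `<=` ratio_domain (val E2).
Proof. by case. Qed.

Definition SOS_incl E1 E2 (h : S_le E1 E2) : SOS_family E1 -> SOS_family E2 :=
  span_incl (S_le_sub h).

Definition UOS0_pos n : set 'M[spanS D]_n :=
  smallest (@convex_cone R (spanS D) n)
    [set X | exists E : S_family, sos_cone (val (val E)) (map_mx (@span_val _) X)].

Lemma UOS0_pos_hermitian n X : @UOS0_pos n X -> hermitian_mx X.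
Proof.
apply; split=> [|Y [E /sos_cone_hermitian /spanS_hermitian //]].
split; rewrite /= /hermitian_mx.
- exact: mxstar0.
- by move=> x y hx hy; rewrite mxstarD hx hy.
- by move=> r x _ hx; rewrite mxstarZr hx.
Qed.

Definition UOS0 : mouData R :=
  MouData UOS0_pos_hermitian (spanS_unit_hermitian D).

Definition UOS : mouData R := arch UOS0.

Definition SOS_to_UOS (E : S_family) : SOS_family E -> UOS :=
  fun x => @arch_proj R UOS0 (span_incl (@S_familyP E) x).

End FixDelta.
End Span.

(* Main.v *)
Require Import Defs.
From HB Require Import structures.
From mathcomp Require Import all_boot all_order all_algebra all_reals.
From mathcomp Require Import generic_quotient ring_quotient finmap complex.
From mathcomp Require Import all_classical all_analysis.
From mathcomp Require Import ring lra.
From mathcomp.analysis Require Import showcase.summability.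
(** Uniqueness and existence of the map out of UOS(Delta) come from following
a single group element.  If g = s t^-1 with s, t in E, then right translation
by t carries {1, g} into E, and multiplying y on the right by a unitary
delta_t changes no square y y^*; so SOS({1, g}) maps to SOS(E) inside the
diagram.  A cocone with vertex Y is therefore given by the values c(g) in Y
that its legs take at delta_g, one value for each g in Delta
(cocone_value_delta).  The delta_g are linearly independent, so c extends to
a linear map S[Delta] -> Y (span_extension), which restricts to the legs
(extension_SOS).  It is positive on the squares that generate the cones of
UOS_0(Delta), hence on the cones (extension_pos), and since Y is Archimedean
positivity survives the passage to the Archimedeanisation
(extension_arch_pos).  Uniqueness holds because the images of the delta_g
span UOS(Delta).

The analytic content is that the objects involved are operator systems, and
it all rests on one functional, the canonical trace tau with
tau(delta_s) = [s = 1] and tau(a^* a) >= 0 (canonical_trace).  It is the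
vector state at the basis vector of 1 in the left regular representation,
which is why the Hilbert space l^2(G) is constructed first; the universal
property of C^*(G) turns this representation of G into one of C^*(G).
The trace is used in four ways.
- The Fourier coefficients tau(x delta_g^-1) show that the delta_g are
  linearly independent (delta_independent).
- The trace of the matrix tau(M), for M a sum of squares, is the sum of the
  squared moduli of all coefficients, so the cones are proper
  (sos_trace_eq0).
- The states x |-> tau(b x star b) / tau(b star b) separate the points of S[Delta],
  so the Archimedeanisation of UOS_0(Delta) divides by the zero space
  (UOS0_null0).
- It bounds Gram matrices, which makes the cones Q_n(E) closed.  A sum of
  squares is the image of a positive semidefinite matrix P with
  index set {1, .., n} x E under
  P |-> sum over s, t of P_(s,t) (x) delta_(s t^-1), and the trace of P equals
  that of the image (sos_gramP).  If r + M is a sum of squares for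
  every r > 0, the corresponding matrices stay bounded, converge along
  an ultrafilter, and their limit is positive semidefinite with image M
  (sos_closed).  This is the Archimedean property of SOS(E).

Order units are found by hand: for s, t in E the square of
c E_ak (x) delta_s + E_bk (x) delta_t is
c E_ab (x) delta_(s t^-1) plus its adjoint plus a diagonal matrix
(dominated_delta).  Finally, the Archimedeanisation of any matrix order unit
space is an operator system (arch_operator_system). *)

Set Implicit Arguments.
Unset Strict Implicit.
Unset Printing Implicit Defensive.
Import Order.TTheory GRing.Theory Num.Theory numFieldNormedType.Exports.
Local Open Scope classical_set_scope.
Local Open Scope complex_scope.
Local Open Scope ring_scope.

(** * Limits of complex numbers *)

Section ComplexLimits.
Variable R : realType.
Local Notation C := R[i].
Local Notation re := (@complex.Re R).
Local Notation im := (@complex.Im R).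

Lemma norm_le_ReIm (z : C) : `|z| <= (`|re z| + `|im z|)%:C.
Proof.
rewrite [z in `|z|]complexE (le_trans (ler_normD _ _))// normrM complexiE normCi.
rewrite mul1r rmorphD /= lerD//= !normc_def /= !lecR -sqrtr_sqr;
  by rewrite expr0n /= ?addr0.
Qed.

Lemma normc_ge_Im (z : C) : `|im z|%:C <= `|z|.
Proof.
rewrite normc_def lecR -sqrtr_sqr ler_wsqrtr// lerDr sqr_ge0 //.
Qed.

Lemma gt0_complexE (e : C) : 0 < e -> exists2 d : R, 0 < d & e = d%:C.
Proof.
case: e => a b; rewrite ltcE /= => /andP[/eqP -> a0]; exists a => //.
Qed.

Lemma cvg_ReIm T (F : set_system T) {FF : Filter F} (u : T -> C^o) (l : C^o) :
  re (u t) @[t --> F] --> re l -> im (u t) @[t --> F] --> im l ->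
  u @ F --> l.
Proof.
move=> /cvgrPdist_lt hr /cvgrPdist_lt hi; apply/cvgrPdist_lt => e e0.
have [d d0 ->] := gt0_complexE e0.
have d2 : 0 < d / 2 by rewrite divr_gt0.
move: (hr _ d2) (hi _ d2); apply: filterS2 => t hrt hit.
apply: le_lt_trans (norm_le_ReIm _) _; rewrite ltcR [ltRHS]splitr ltrD//.
- by case: l {hr hi} (u t) hrt {hit} => [? ?] [? ?].
- by case: l {hr hi} (u t) hit {hrt} => [? ?] [? ?].
Qed.

Lemma cvg_conj T (F : set_system T) {FF : Filter F} (u : T -> C^o) (l : C^o) :
  u @ F --> l -> (u t)^* @[t --> F] --> (l^* : C^o).
Proof.
move=> /cvgrPdist_lt h; apply/cvgrPdist_lt => e /h; apply: filterS => t.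
by rewrite -rmorphB norm_conjC.
Qed.

(** The order on C compares real parts of numbers with equal imaginary
parts, so closedness of the positive half-line is not an instance of the
theorem for totally ordered fields. *)
Lemma cvg_ge0 T (F : set_system T) {FF : ProperFilter F} (u : T -> C^o) (l : C^o) :
  (\forall t \near F, 0 <= u t) -> u @ F --> l -> 0 <= l.
Proof.
move=> u0 /cvgrPdist_lt ul.
have key (d : R) : 0 < d -> 0 <= re l + d /\ `|im l| <= d.
  move=> d0; have dC : 0 < d%:C by rewrite ltcR.
  have [t [ut /ltW lt]] := filter_ex (filterI u0 (ul _ dC)).
  have hr := le_trans (normc_ge_Re _) lt; have hi := le_trans (normc_ge_Im _) lt.
  move: ut hr hi {lt ul}; rewrite !lecR.
  case: l (u t) => [a b] [a' b']; rewrite lecE /= => /andP[/eqP -> a0].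
  rewrite oppr0 addr0 ler_norml => /andP[h _] ->; split=> //.
  by lra.
rewrite lecE /=; apply/andP; split.
  by rewrite -normr_le0; apply/ler_addgt0Pl => d /key[_]; rewrite addr0.
by apply/ler_addgt0Pl => d /key[]; rewrite addrC.
Qed.

(** The laws of limits for functions into C, restated with the sums and
products of C itself: the topology lives on C^o, and identifying the two
ring structures anew at each use is expensive. *)
Lemma cvgC_add T (F : set_system T) {FF : Filter F} (u v : T -> C) (a b : C) :
  (u : T -> C^o) @ F --> (a : C^o) -> (v : T -> C^o) @ F --> (b : C^o) ->
  ((fun t => u t + v t) : T -> C^o) @ F --> (a + b : C^o).
Proof. exact: (@cvgD _ C^o). Qed.

Lemma cvgC_sub T (F : set_system T) {FF : Filter F} (u v : T -> C) (a b : C) :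
  (u : T -> C^o) @ F --> (a : C^o) -> (v : T -> C^o) @ F --> (b : C^o) ->
  ((fun t => u t - v t) : T -> C^o) @ F --> (a - b : C^o).
Proof. exact: (@cvgB _ C^o). Qed.

Lemma cvgC_mull T (F : set_system T) {FF : Filter F} (c : C) (u : T -> C) (a : C) :
  (u : T -> C^o) @ F --> (a : C^o) ->
  ((fun t => c * u t) : T -> C^o) @ F --> (c * a : C^o).
Proof. exact: (@cvgZl_tmp _ C^o). Qed.

Lemma cvgC_mul T (F : set_system T) {FF : Filter F} (u v : T -> C) (a b : C) :
  (u : T -> C^o) @ F --> (a : C^o) -> (v : T -> C^o) @ F --> (b : C^o) ->
  ((fun t => u t * v t) : T -> C^o) @ F --> (a * b : C^o).
Proof. exact: (@cvgZ _ C^o). Qed.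

Lemma cvgC_sum T (F : set_system T) {FF : Filter F} J (r : seq J) (P : pred J)
    (u : J -> T -> C) (l : J -> C) :
  (forall i, (u i : T -> C^o) @ F --> (l i : C^o)) ->
  ((fun t => \sum_(i <- r | P i) u i t) : T -> C^o) @ F -->
    (\sum_(i <- r | P i) l i : C^o).
Proof.
move=> h; elim: r => [|i r IH].
  by rewrite big_nil; under eq_fun do rewrite big_nil; exact: cvg_cst.
rewrite big_cons; under eq_fun do rewrite big_cons.
by case: (P i) => //; exact: cvgC_add (h i) IH.
Qed.

(** Completeness of C, from that of R applied to real and imaginary parts. *)
Lemma complex_cauchy_cvg T (F : set_system T) {FF : ProperFilter F}
    (u : T -> C^o) :
  (forall d : R, 0 < d -> exists c, \forall t \near F, `|c - u t| < d%:C) ->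
  exists l : C^o, u @ F --> l.
Proof.
move=> h.
have part (p : C -> R) : (forall x y, p (x - y) = p x - p y) ->
    (forall z, `|p z|%:C <= `|z|) -> exists l : R, p (u t) @[t --> F] --> l.
  move=> pB pn; apply/cvg_ex; apply: R_complete; apply/cauchyP => e e0.
  have [c hc] := h e e0; exists (p c).
  have : \forall t \near F, ball (p c) e (p (u t)); last exact.
  apply: filterS hc => t; rewrite -ball_normE /ball_ /= -pB -ltcR.
  exact: le_lt_trans (pn _).
have [a ha] : exists l : R, re (u t) @[t --> F] --> l.
  by apply: part; [case=> ? ? [] | exact: normc_ge_Re].
have [b hb] : exists l : R, im (u t) @[t --> F] --> l.
  by apply: part; [case=> ? ? [] | exact: normc_ge_Im].
by exists (a +i* b); exact: cvg_ReIm.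
Qed.

End ComplexLimits.

(** * The Hilbert space of square-summable functions *)

Lemma mulr_conj_polarize (F : numClosedFieldType) (a b : F) :
  a * b^* = 4^-1 * (`|a + b| ^+ 2 - `|a - b| ^+ 2 +
    'i * `|a + 'i * b| ^+ 2 - 'i * `|a - 'i * b| ^+ 2).
Proof.
rewrite !normCK !(rmorphB, rmorphD, rmorphM, rmorphN) /= conjCi.
move: ('i) (sqrCi F) => j j2.
transitivity (4^-1 * (2 * (a * b^* + b * a^*) + 2 * j ^+ 2 * (b * a^* - a * b^*))).
  by rewrite j2; field.
by ring.
Qed.

(* Sums over I are limits of finite partial sums along this filter. *)
#[local] Existing Instance totally_filter.

Section SquareSummable.
Variables (R : realType) (I : choiceType).
Local Notation C := R[i].
Implicit Types (x y z : I -> C^o) (E : {fset I}).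

Definition sqsum x E : C^o := \sum_(s <- E) `|x s| ^+ 2.
Definition crosssum x y E : C^o := \sum_(s <- E) x s * (y s)^*.

Lemma sqsumE x : sqsum x = crosssum x x.
Proof. by apply/funext => E; apply: eq_bigr => s _; rewrite normCK. Qed.

Lemma sqsum_ge0 x E : 0 <= sqsum x E.
Proof. by apply: sumr_ge0 => s _; rewrite exprn_ge0. Qed.

Lemma sqsum_le x E E' : (E `<=` E')%fset -> sqsum x E <= sqsum x E'.
Proof.
move=> EE'; rewrite /sqsum (big_fsetID _ (mem E) E') /=.
have -> : [fset s in E' | s \in E]%fset = E.
  apply/fsetP => s; rewrite !inE /=; apply: andb_idl; exact: fsubsetP.
by rewrite lerDl sumr_ge0// => s _; rewrite exprn_ge0.
Qed.

Definition sqsummable : {pred I -> C^o} :=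
  [pred x | `[< exists M : R, forall E, sqsum x E <= M%:C >]].

Lemma sqsummableP x :
  reflect (exists M : R, forall E, sqsum x E <= M%:C) (x \in sqsummable).
Proof. exact: asboolP. Qed.

Lemma sqsummable_submod_closed : submod_closed sqsummable.
Proof.
split=> [|a x y /sqsummableP[M xM] /sqsummableP[N yN]]; apply/sqsummableP.
  by exists 0 => E; rewrite /sqsum big1// => s _; rewrite normr0 expr0n.
have [c hc] : exists c : R, `|a| ^+ 2 = c%:C by rewrite -add_Re2_Im2; eexists.
exists (2 * c * M + 2 * N) => E.
have -> : (2 * c * M + 2 * N)%:C = 2 * `|a| ^+ 2 * M%:C + 2 * N%:C :> C.
  by rewrite hc !(rmorphD, rmorphM, rmorph_nat).
have -> : sqsum (a *: x + y) E = \sum_(s <- E) `|a * x s + y s| ^+ 2 by [].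
apply: le_trans (_ : 2 * `|a| ^+ 2 * sqsum x E + 2 * sqsum y E <= _); last first.
  by rewrite lerD ?ler_wpM2l ?mulr_ge0 ?exprn_ge0.
rewrite /sqsum !mulr_sumr -big_split /=; apply: ler_sum => s _.
rewrite -mulrA -exprMn -normrM -subr_ge0.
have -> : 2 * `|a * x s| ^+ 2 + 2 * `|y s| ^+ 2 - `|a * x s + y s| ^+ 2 =
   `|a * x s - y s| ^+ 2.
  by rewrite !normCK !(rmorphD, rmorphN) /=; ring.
by rewrite exprn_ge0.
Qed.

HB.instance Definition _ :=
  GRing.isSubmodClosed.Build C (I -> C^o) sqsummable sqsummable_submod_closed.

(** The partial sums increase with the finite set and are bounded, so they
converge to their supremum; polarization reduces the convergence of inner
products to this case. *)
Lemma sqsum_cvg x : x \in sqsummable -> exists2 l : R,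
  sqsum x @ totally --> (l%:C : C^o) & forall E, sqsum x E <= l%:C.
Proof.
move=> /sqsummableP[M xM].
pose S E := complex.Re (sqsum x E).
have SE E : sqsum x E = (S E)%:C by rewrite /S RRe_real ?ger0_real ?sqsum_ge0.
have hS : has_sup [set S E | E in setT].
  split; first by exists (S fset0), fset0.
  by exists M => _ [E _ <-]; rewrite -lecR -SE.
have ubS E : S E <= sup [set S E | E in setT].
  by apply: (sup_upper_bound hS); exists E.
exists (sup [set S E | E in setT]); last by move=> E; rewrite SE lecR.
apply/cvgrPdist_lt => e /gt0_complexE[d d0 ->].
have [_ [E _ <-] hE] := sup_adherent d0 hS.
exists E => //= E' EE'; rewrite SE -rmorphB ger0_norm ?ler0c ?subr_ge0// ltcR.
have : S E <= S E' by rewrite -lecR -!SE sqsum_le.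
by move: (ubS E'); set s := sup _ in hE * => *; lra.
Qed.

Lemma crosssum_polarize x y E : crosssum x y E =
  4^-1 * (sqsum (x + y) E - sqsum (x - y) E +
    'i * sqsum (x + 'i *: y) E - 'i * sqsum (x - 'i *: y) E).
Proof.
rewrite /sqsum !mulr_sumr -!sumrB -!big_split /= -!sumrB mulr_sumr.
by apply: eq_bigr => s _; exact: mulr_conj_polarize.
Qed.

Record ell2 := Ell2 { ell2_val :> I -> C^o; ell2P : ell2_val \in sqsummable }.
HB.instance Definition _ := [isSub of ell2 for ell2_val].
HB.instance Definition _ := [Choice of ell2 by <:].
HB.instance Definition _ := [SubChoice_isSubLmodule of ell2 by <:].

Implicit Types (f g h : ell2).

Definition ell2_inner f g : C := lim (crosssum f g @ totally).

(** By polarization the sum of x_s conj(y_s) is a combination of four sums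
of squared moduli of elements of the space. *)
Lemma crosssum_cvg f g : crosssum f g @ totally --> (ell2_inner f g : C^o).
Proof.
suff [l hl] : exists l : C^o, crosssum f g @ totally --> l.
  by rewrite /ell2_inner (cvg_lim _ hl)//; exact: norm_hausdorff.
have q h : exists l : C^o, sqsum h @ totally --> l.
  by have [l hl _] := sqsum_cvg (ell2P h); exists l%:C.
have [l1 h1] := q (f + g); have [l2 h2] := q (f - g).
have [l3 h3] := q (f + 'i *: g); have [l4 h4] := q (f - 'i *: g).
exists (4^-1 * (l1 - l2 + 'i * l3 - 'i * l4)).
have -> : crosssum f g = fun E => 4^-1 * (sqsum (f + g : ell2) E -
    sqsum (f - g : ell2) E + 'i * sqsum (f + 'i *: g : ell2) E -
    'i * sqsum (f - 'i *: g : ell2) E).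
  by apply/funext => E; rewrite crosssum_polarize.
apply: cvgC_mull.
exact: cvgC_sub (cvgC_add (cvgC_sub h1 h2) (cvgC_mull h3)) (cvgC_mull h4).
Qed.

Lemma ell2_innerP f g (l : C^o) :
  crosssum f g @ totally --> l -> ell2_inner f g = l.
Proof. by move=> hl; rewrite /ell2_inner (cvg_lim _ hl)//; exact: norm_hausdorff. Qed.

Lemma ell2_inner_linear (a : C) f g h :
  ell2_inner (a *: f + g) h = a * ell2_inner f h + ell2_inner g h.
Proof.
apply: ell2_innerP.
have -> : crosssum (a *: f + g : ell2) h =
    fun E => a * crosssum f h E + crosssum g h E.
  apply/funext => E; rewrite /crosssum mulr_sumr -big_split /=.
  by apply: eq_bigr => s _; rewrite mulrA -mulrDl.
exact: cvgC_add (cvgC_mull (@crosssum_cvg f h)) (@crosssum_cvg g h).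
Qed.

Lemma ell2_inner_conj f g : ell2_inner g f = (ell2_inner f g)^*.
Proof.
apply: ell2_innerP.
have -> : crosssum g f = fun E => (crosssum f g E)^*.
  apply/funext => E; rewrite /crosssum rmorph_sum; apply: eq_bigr => s _.
  by rewrite rmorphM /= conjCK mulrC.
exact: cvg_conj (@crosssum_cvg f g).
Qed.

Lemma sqsum_le_inner f E : sqsum f E <= ell2_inner f f.
Proof.
have [l hl hle] := sqsum_cvg (ell2P f).
suff -> : ell2_inner f f = l%:C by exact: hle.
by apply: ell2_innerP; rewrite -sqsumE.
Qed.

Lemma inner_le_sqsum f (M : C) : (forall E, sqsum f E <= M) -> ell2_inner f f <= M.
Proof.
move=> fM; rewrite -subr_ge0.
have hM : ((fun=> M) : {fset I} -> C^o) @ totally --> (M : C^o) by exact: cvg_cst.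
have := @crosssum_cvg f f; rewrite -sqsumE => /(cvgC_sub hM).
by apply: cvg_ge0; apply: filterE => E; rewrite subr_ge0.
Qed.

Lemma ell2_inner_ge0 f : 0 <= ell2_inner f f.
Proof. exact: le_trans (sqsum_ge0 _ fset0) (sqsum_le_inner _ _). Qed.

Lemma ell2_inner_eq0 f : ell2_inner f f = 0 -> f = 0.
Proof.
move=> f0; apply: val_inj; apply/funext => s /=.
have := sqsum_le_inner f [fset s]%fset; rewrite f0 /sqsum big_seq_fset1.
move=> h; apply/eqP; rewrite -normr_eq0 -sqrf_eq0; apply/eqP/le_anti.
by rewrite h exprn_ge0.
Qed.

Lemma ell2_inner0 f : ell2_inner 0 f = 0.
Proof. by have := ell2_inner_linear (-1) 0 0 f; rewrite scaler0 addr0 mulN1r addNr. Qed.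

Definition ell2_norm f : C := sqrtC (ell2_inner f f).

Lemma ell2_inner_sqr f g (a b : C) : a \is Num.real -> b \is Num.real ->
  ell2_inner (a *: f + b *: g) (a *: f + b *: g) =
  a ^+ 2 * ell2_inner f f + b ^+ 2 * ell2_inner g g +
  a * b * (ell2_inner f g + ell2_inner g f).
Proof.
move=> /CrealP ar /CrealP br.
have ll (c : C) h k : ell2_inner (c *: h) k = c * ell2_inner h k.
  by rewrite -[c *: h]addr0 ell2_inner_linear ell2_inner0 addr0.
have lr (c : C) h k : ell2_inner h (c *: k) = c^* * ell2_inner h k.
  by rewrite ell2_inner_conj ll rmorphM /= -ell2_inner_conj.
rewrite ell2_inner_linear ll.
rewrite ell2_inner_conj (ell2_inner_conj _ g) !ell2_inner_linear !ll.
rewrite !rmorphD !rmorphM /= ar br -!ell2_inner_conj; ring.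
Qed.

(** With p = |f| and r = |g| positive, the inequality 0 <= |r f - p g|^2
says 2 Re(f, g) <= 2 p r, which gives |f + g|^2 <= (p + r)^2 at once. *)
Lemma ell2_normD f g : ell2_norm (f + g) <= ell2_norm f + ell2_norm g.
Proof.
have ge0 h : 0 <= ell2_norm h by rewrite sqrtC_ge0 ell2_inner_ge0.
have sq h : ell2_inner h h = ell2_norm h ^+ 2 by rewrite sqrtCK.
have [f0|f0] := eqVneq (ell2_norm f) 0.
  by have /ell2_inner_eq0 -> : ell2_inner f f = 0; rewrite ?sq ?f0 ?expr0n// add0r ler_wpDl.
have [g0|g0] := eqVneq (ell2_norm g) 0.
  by have /ell2_inner_eq0 -> : ell2_inner g g = 0; rewrite ?sq ?g0 ?expr0n// addr0 ler_wpDr.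
set p := ell2_norm f; set r := ell2_norm g.
set S := ell2_inner f g + ell2_inner g f.
have [p0 r0] : 0 < p /\ 0 < r by rewrite !lt_def f0 g0 !ge0.
have Sle : S <= 2 * p * r.
  have := ell2_inner_ge0 (r *: f + (- p) *: g).
  rewrite ell2_inner_sqr ?rpredN //; try exact/ger0_real/ge0.
  rewrite (sq f) (sq g) -/p -/r -/S.
  rewrite (_ : _ + _ = p * r * (2 * p * r - S)); last by ring.
  by rewrite pmulr_rge0 ?mulr_gt0// subr_ge0.
have := ell2_inner_sqr f g (rpred1 _) (rpred1 _).
rewrite !scale1r (sq f) (sq g) (sq (f + g)) -/p -/r -/S => E.
have prE : (p + r) ^+ 2 = 1 ^+ 2 * p ^+ 2 + 1 ^+ 2 * r ^+ 2 + 1 * 1 * (2 * p * r).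
  by ring.
have : ell2_norm (f + g) ^+ 2 <= (p + r) ^+ 2 by rewrite E prE !mul1r lerD2l.
by rewrite ler_sqr ?nnegrE ?addr_ge0 ?ge0.
Qed.

Lemma ell2_normZ (a : C) f : ell2_norm (a *: f) = `|a| * ell2_norm f.
Proof.
have := ell2_inner_linear a f 0 (a *: f); rewrite addr0 ell2_inner0 addr0.
rewrite /ell2_norm => ->; rewrite ell2_inner_conj.
have := ell2_inner_linear a f 0 f; rewrite addr0 ell2_inner0 addr0 => ->.
rewrite rmorphM /= mulrA -normCK -ell2_inner_conj sqrtCM ?nnegrE ?exprn_ge0 ?ell2_inner_ge0//.
by rewrite sqrCK.
Qed.

Lemma ell2_norm_eq0 f : ell2_norm f = 0 -> f = 0.
Proof. by move/eqP; rewrite sqrtC_eq0 => /eqP/ell2_inner_eq0. Qed.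

HB.instance Definition _ := Lmodule_isNormed.Build C ell2
  ell2_normD ell2_normZ ell2_norm_eq0.

Lemma ell2_inner_norm f : ell2_inner f f = `|f| ^+ 2.
Proof. by rewrite sqrtCK. Qed.

Lemma norm_coord_le f s : `|f s| <= `|f|.
Proof.
rewrite -ler_sqr ?nnegrE// -ell2_inner_norm.
by have := sqsum_le_inner f [fset s]%fset; rewrite /sqsum big_seq_fset1.
Qed.

(** A Cauchy filter converges pointwise, because coordinates are bounded by
the norm.  For f0 within d of most elements of the filter, each finite
partial sum of |f0 - l|^2 is a limit of numbers at most d^2, so f0 - l is
square-summable of norm at most d. *)
Lemma ell2_complete (F : set_system ell2) : ProperFilter F -> cauchy F -> cvg F.
Proof.
move=> FF /cauchyP cF.
have near_center (e : C) : 0 < e -> exists f0 : ell2, \forall f \near F, `|f0 - f| < e.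
  by move=> /cF[f0 hf]; exists f0; apply: filterS hf => f; rewrite -ball_normE.
have /choice[l hl] s : exists l : C^o, f s @[f --> F] --> l.
  apply: complex_cauchy_cvg => d d0.
  have [|f0 hf] := near_center d%:C; first by rewrite ltcR.
  exists (f0 s); apply: filterS hf => f; apply: le_lt_trans.
  exact: norm_coord_le (f0 - f) s.
have tail (f0 : ell2) (d : R) : 0 < d -> (\forall f \near F, `|f0 - f| < d%:C) ->
    forall E, sqsum ((f0 : I -> C^o) - l) E <= d%:C ^+ 2.
  move=> d0 hf E; rewrite -subr_ge0.
  pose u (f : ell2) s : C := f0 s - f s.
  have hu s : ((fun f => u f s) : ell2 -> C^o) @ F --> (f0 s - l s : C^o).
    by apply: cvgC_sub; [exact: cvg_cst | exact: hl].
  have hsum : ((fun f => \sum_(s <- E) u f s * (u f s)^*) : ell2 -> C^o) @ F -->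
      (\sum_(s <- E) (f0 s - l s) * (f0 s - l s)^* : C^o).
    by apply: cvgC_sum => s; apply: cvgC_mul; [exact: hu | apply: cvg_conj; exact: hu].
  have hd : ((fun=> d%:C ^+ 2) : ell2 -> C^o) @ F --> (d%:C ^+ 2 : C^o).
    exact: cvg_cst.
  have -> : sqsum ((f0 : I -> C^o) - l) E =
      \sum_(s <- E) (f0 s - l s) * (f0 s - l s)^* by rewrite sqsumE.
  apply: cvg_ge0 (cvgC_sub hd hsum); apply: filterS hf => f hf.
  have -> : \sum_(s <- E) u f s * (u f s)^* = sqsum (f0 - f : ell2) E.
    by rewrite sqsumE.
  rewrite subr_ge0 (le_trans (sqsum_le_inner _ _))// ell2_inner_norm.
  by rewrite ler_sqr ?nnegrE ?ler0c ?(ltW hf) ?(ltW d0).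
have [f0 hf0] := near_center 1 ltr01.
have dl : (f0 : I -> C^o) - l \in sqsummable.
  by apply/sqsummableP; exists (1 ^+ 2) => E; rewrite rmorphXn; apply: (tail f0 1).
have lP : l \in sqsummable.
  by rewrite -[l](subKr (f0 : I -> C^o)) rpredB ?ell2P.
apply/cvg_ex; exists (Ell2 lP); apply/fcvgrPdist_lt => e e0.
have [d d0 ed] := gt0_complexE e0.
have d2 : 0 < d / 2 by rewrite divr_gt0.
have [|g hg] := near_center (d / 2)%:C; first by rewrite ltcR.
have gl : `|g - Ell2 lP| <= (d / 2)%:C.
  rewrite -ler_sqr ?nnegrE ?ler0c ?(ltW d2)// -ell2_inner_norm.
  by apply: inner_le_sqsum => E; apply: (tail g (d / 2)).
apply: filterS hg => f hf; rewrite ed [d]splitr rmorphD /=.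
by rewrite -(subrKA g) (le_lt_trans (ler_normD _ _))// ler_ltD// distrC.
Qed.

HB.instance Definition _ := Uniform_isComplete.Build ell2 ell2_complete.

HB.instance Definition _ := isHilbert.Build R ell2
  ell2_inner_linear ell2_inner_conj ell2_inner_norm.

End SquareSummable.

(** * The left regular representation and the canonical trace *)

Section RegularRepresentation.
Variables (R : realType) (G : groupType).
Local Notation C := R[i].
Local Notation H := (ell2 R G).
Implicit Types (s t : G) (f g : H) (E : {fset G}).

Lemma crosssum_translate (x y : G -> C^o) s E :
  crosssum (fun t => x (s * t)%g) (fun t => y (s * t)%g) E =
  crosssum x y [fset (s * t)%g | t in E]%fset.
Proof.
by rewrite /crosssum big_imfset//= => t u _ _; exact: mulgI.
Qed.

Lemma sqsummable_translate s f :
  (fun t => f (s^-1 * t)%g) \in @sqsummable R G.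
Proof.
have /sqsummableP[M fM] := ell2P f; apply/sqsummableP; exists M => E.
by rewrite sqsumE (crosssum_translate f f) -sqsumE.
Qed.

Definition translate s f : H := Ell2 (sqsummable_translate s f).

(** For the inner product: translating both functions by s replaces the
partial sum over E by the one over s^-1 E, and E |-> s^-1 E preserves the
filter of large finite sets. *)
Lemma translate_unitary : unitary_rep translate.
Proof.
split.
- by move=> s a f g; exact: val_inj.
- by move=> f; apply: val_inj; apply/funext => t /=; rewrite invg1 mul1g.
- by move=> s t f; apply: val_inj; apply/funext => u /=; rewrite invgM mulgA.
- move=> s f g; apply: ell2_innerP.
  have -> : crosssum (translate s f) (translate s g) =
      crosssum f g \o (fun E => [fset (s^-1 * t)%g | t in E]%fset).
    by apply/funext => E; exact: crosssum_translate.
  apply: cvg_comp (@crosssum_cvg _ _ f g) => P [A _ AP].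
  exists [fset (s * t)%g | t in A]%fset => //= B AB; apply: AP.
  apply/fsubsetP => t tA; apply/imfsetP; exists (s * t)%g; last by rewrite mulKg.
  by apply: (fsubsetP AB); apply/imfsetP; exists t.
Qed.

Lemma sqsummable_basis s : (fun t => (s == t)%:R) \in @sqsummable R G.
Proof.
apply/sqsummableP; exists 1 => E; rewrite /sqsum.
have [sE|sE] := boolP (s \in E).
  rewrite (big_fsetD1 s)//= eqxx normr1 expr1n big_seq big1 ?addr0// => t.
  by rewrite !inE eq_sym => /andP[/negPf -> _]; rewrite normr0 expr0n.
rewrite big_seq big1 ?ler0c// => t tE; case: eqP => [st|]; last first.
  by rewrite normr0 expr0n.
by rewrite st tE in sE.
Qed.

Definition ell2_basis s : H := Ell2 (sqsummable_basis s).

Lemma translate_basis s t : translate s (ell2_basis t) = ell2_basis (s * t)%g.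
Proof.
apply: val_inj; apply/funext => u /=.
by rewrite -(inj_eq (mulgI s)) mulVKg.
Qed.

Lemma inner_basis s t : inner (ell2_basis s) (ell2_basis t) = (s == t)%:R.
Proof.
apply: ell2_innerP; apply/cvgrPdist_lt => e e0.
exists [fset t]%fset => // E /fsubsetP/(_ t (fset11 _)) tE /=.
rewrite /crosssum (big_fsetD1 t)//= eqxx rmorph1 mulr1 big_seq big1 ?addr0 ?subrr ?normr0//.
by move=> u; rewrite !inE eq_sym => /andP[/negPf -> _]; rewrite rmorph0 mulr0.
Qed.

(** The vector state at the basis vector e_1: there delta_s e_1 = e_s, and
tau(a^* a) is the squared norm of a e_1. *)
Lemma canonical_trace (A : groupCstar R G) : exists tau : {scalar A},
  (forall s, tau (delta A s) = (s == 1%g)%:R) /\ (forall a, 0 <= tau (star a * a)).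
Proof.
have [rho rhoP rhoE] := delta_universal A translate_unitary.
pose t a : C := inner (rho a (ell2_basis 1%g)) (ell2_basis 1%g).
have t_lin : scalar t.
  by move=> c a b; rewrite /t (srep_alg_linear rhoP) inner_linear.
pose tau : {scalar A} := HB.pack t (GRing.isLinear.Build C A C _ t t_lin).
exists tau; split=> [s|a]; rewrite /tau /= /t.
  by rewrite rhoE translate_basis mulg1 inner_basis.
by rewrite (srep_mul rhoP) (srep_star rhoP) starK inner_norm exprn_ge0.
Qed.

End RegularRepresentation.

(** * Finite combinations of group elements *)

Section GroupAlgebra.
Variables (R : realType) (G : groupType) (A : groupCstar R G).
Local Notation C := R[i].
Local Notation d := (delta A).
Implicit Types (s t g h : G) (E : {fset G}).

Section Coefficients.
Variable tau : {scalar A}.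
Hypothesis tau_delta : forall s, tau (d s) = (s == 1%g)%:R.

(** The coefficient of delta_g in x. *)
Definition fourier (x : A) g : C := tau (x * d g^-1%g).

Lemma fourierD x y g : fourier (x + y) g = fourier x g + fourier y g.
Proof. by rewrite /fourier mulrDl linearD. Qed.

Lemma fourierZ a x g : fourier (a *: x) g = a * fourier x g.
Proof. by rewrite /fourier -scalerAl linearZ. Qed.

Lemma fourier0 g : fourier 0 g = 0.
Proof. by rewrite /fourier mul0r linear0. Qed.

Lemma fourier_sum I (r : seq I) (P : pred I) (F : I -> A) g :
  fourier (\sum_(i <- r | P i) F i) g = \sum_(i <- r | P i) fourier (F i) g.
Proof. by rewrite /fourier mulr_suml linear_sum. Qed.

Lemma fourier_delta s g : fourier (d s) g = (s == g)%:R.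
Proof. by rewrite /fourier -deltaM tau_delta -(inj_eq (mulIg g)) mulgVK mul1g. Qed.

(** The coefficients of x = sum c_p delta_p determine the corresponding
combination of any other family c.  For x = 0 this is linear independence;
for c = delta it says that x is the sum of its Fourier series. *)
Lemma lincomb_fourierE (V : lmodType C) (c : G -> V) (l : seq (C * G)) :
  \sum_(p <- l) p.1 *: c p.2 =
  \sum_(g <- undup [seq p.2 | p <- l]) fourier (\sum_(p <- l) p.1 *: d p.2) g *: c g.
Proof.
under [RHS]eq_bigr => g _ do rewrite fourier_sum scaler_suml.
rewrite exchange_big /= big_seq [RHS]big_seq; apply: eq_bigr => p pl.
have p2 : p.2 \in undup [seq p.2 | p <- l] by rewrite mem_undup map_f.
rewrite (bigD1_seq _ p2) ?undup_uniq //= fourierZ fourier_delta eqxx mulr1.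
rewrite big1 ?addr0// => g; rewrite fourierZ fourier_delta eq_sym => /negPf ->.
by rewrite mulr0 scale0r.
Qed.

Lemma delta_independent (V : lmodType C) (c : G -> V) (l : seq (C * G)) :
  \sum_(p <- l) p.1 *: d p.2 = 0 -> \sum_(p <- l) p.1 *: c p.2 = 0.
Proof.
by move=> l0; rewrite lincomb_fourierE l0 big1// => g _; rewrite fourier0 scale0r.
Qed.

Lemma fourier_eq0 (D : set G) x : in_span d D x -> (forall g, fourier x g = 0) -> x = 0.
Proof.
move=> [l _ ->] x0; rewrite lincomb_fourierE big1// => g _.
by rewrite x0 scale0r.
Qed.

End Coefficients.

Definition lincomb E (w : G -> C) : A := \sum_(s <- E) w s *: d s.

Lemma lincomb_mul_star E v w : lincomb E v * star (lincomb E w) =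
  \sum_(s <- E) \sum_(t <- E) (v s * (w t)^*) *: d (s * t^-1)%g.
Proof.
rewrite /lincomb star_sum mulr_suml; apply: eq_bigr => s _.
rewrite mulr_sumr; apply: eq_bigr => t _.
by rewrite starZ star_delta -scalerAl -scalerAr scalerA deltaM.
Qed.

Lemma lincombZ E a w : lincomb E (fun s => a * w s) = a *: lincomb E w.
Proof. by rewrite /lincomb scaler_sumr; apply: eq_bigr => s _; rewrite scalerA. Qed.

Lemma lincomb_sum E I (r : seq I) (F : I -> G -> C) :
  lincomb E (fun s => \sum_(i <- r) F i s) = \sum_(i <- r) lincomb E (F i).
Proof.
by rewrite /lincomb exchange_big; apply: eq_bigr => s _; rewrite scaler_suml.
Qed.

Lemma lincomb1 E s a : s \in E -> lincomb E (fun t => (t == s)%:R * a) = a *: d s.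
Proof.
move=> sE; rewrite /lincomb (big_fsetD1 s)//= eqxx mul1r big_seq big1 ?addr0// => t.
by rewrite !inE => /andP[/negPf -> _]; rewrite mul0r scale0r.
Qed.

Lemma sos_factorE n E (B : G -> 'M[C]_n) i j :
  sos_factor A E B i j = lincomb E (fun s => B s i j).
Proof. by rewrite /sos_factor summxE; apply: eq_bigr => s _; rewrite mxE. Qed.

(** The square y y^* of an n x n matrix y is the sum of the squares of its
columns, so squares may be taken of columns only, indexed by any finite type.
In the other direction a column becomes the first column of a matrix; for
n = 0 there is no first column, and no entry to check either. *)
Lemma sos_coneP n E (M : 'M[A]_n) : sos_cone E M <->
  exists (K : finType) (v : K -> 'I_n -> G -> C),
    forall i j, M i j = \sum_k lincomb E (v k i) * star (lincomb E (v k j)).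
Proof.
split=> [[r [B ->]]|[K [v Mv]]].
  exists ('I_r * 'I_n)%type, (fun k i s => B k.1 s i k.2) => i j.
  rewrite summxE; under eq_bigr => k _ do rewrite mxE.
  rewrite pair_bigA; apply: eq_bigr => -[k l] _ /=.
  by rewrite mxE !sos_factorE.
exists #|K|.
exists (fun k s => \matrix_(i, j) (v (enum_val k) i s * (val j == 0)%:R)).
apply/matrixP => i j; rewrite Mv summxE (reindex_onto enum_val enum_rank) /=; last first.
  by move=> k _; rewrite enum_rankK.
under eq_bigl => k do rewrite enum_valK eqxx.
apply: eq_bigr => k _; rewrite mxE.
have n0 : (0 < n)%N by case: n i {M Mv j v} => [[]|].
rewrite (bigD1 (Ordinal n0))//= big1 ?addr0 => [|l l0].
  by rewrite mxE !sos_factorE; congr (_ * star _); apply: eq_bigr => s _; rewrite mxE mulr1.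
rewrite sos_factorE /lincomb big1 ?mul0r// => s _; rewrite mxE.
by rewrite -(inj_eq val_inj)/= in l0; rewrite (negPf l0) mulr0 scale0r.
Qed.

Lemma sos_add n E (M N : 'M[A]_n) :
  sos_cone E M -> sos_cone E N -> sos_cone E (M + N).
Proof.
move=> /sos_coneP[K [v Mv]] /sos_coneP[L [w Nw]]; apply/sos_coneP.
exists (K + L)%type, (fun k => match k with inl k => v k | inr k => w k end) => i j.
by rewrite mxE Mv Nw big_sumType.
Qed.

Lemma sos0 n E : sos_cone E (0 : 'M[A]_n).
Proof.
by apply/sos_coneP; exists void, (fun=> fun=> fun=> 0) => i j; rewrite mxE big1 // => -[].
Qed.

Lemma sos_compress m n E (alpha : 'M[C]_(n, m)) (M : 'M[A]_m) :
  sos_cone E M -> sos_cone E (mxcompress alpha M).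
Proof.
move=> /sos_coneP[K [v Mv]]; apply/sos_coneP.
exists K, (fun k i s => \sum_c alpha i c * v k c s) => i j.
rewrite mxE; under eq_bigr => c _ do under eq_bigr => e _ do rewrite Mv scaler_sumr.
under eq_bigr => c _ do rewrite exchange_big.
rewrite exchange_big; apply: eq_bigr => k _ /=.
rewrite !lincomb_sum star_sum mulr_suml; apply: eq_bigr => c _.
rewrite mulr_sumr; apply: eq_bigr => e _.
by rewrite !lincombZ starZ -scalerAl -scalerAr scalerA.
Qed.

Lemma sos_scale n E (r : R) (M : 'M[A]_n) : 0 <= r ->
  sos_cone E M -> sos_cone E (mxscale r%:C M).
Proof.
move=> r0 /sos_coneP[K [v Mv]]; apply/sos_coneP.
exists K, (fun k i s => (Num.sqrt r)%:C * v k i s) => i j.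
rewrite mxE Mv scaler_sumr; apply: eq_bigr => k _.
rewrite !lincombZ starZ -scalerAl -scalerAr scalerA conj_Creal ?complex_real//.
by rewrite -rmorphM -expr2 sqr_sqrtr.
Qed.

(** Right multiplication of y by the unitary delta_h does not change y y^*.
For h = 1 this is monotonicity in E. *)
Lemma sos_translate n E E' h (M : 'M[A]_n) :
  (forall s, s \in E -> (s * h)%g \in E') -> sos_cone E M -> sos_cone E' M.
Proof.
move=> EE' /sos_coneP[K [v Mv]]; apply/sos_coneP.
(* coefficients over E' of y delta_h, extended by zero *)
pose w k i t := (t * h^-1 \in E)%g%:R * v k i (t * h^-1)%g.
exists K, w => i j.
have wE k l : lincomb E' (w k l) = lincomb E (v k l) * d h.
  rewrite /lincomb mulr_suml.
  have -> : \sum_(s <- E) v k l s *: d s * d h =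
      \sum_(t <- [fset (s * h)%g | s in E]%fset) w k l t *: d t.
    rewrite big_imfset /=; last by move=> s t _ _; exact: mulIg.
    rewrite big_seq [RHS]big_seq; apply: eq_bigr => s sE.
    by rewrite /w mulgK sE mul1r deltaM -scalerAl.
  apply: esym; apply: big_fset_incl => [|t tE'].
    by apply/fsubsetP => _ /imfsetP[s sE ->]; exact: EE'.
  move=> tE; rewrite /w; case: (boolP (_ \in E)) => [tE2|]; rewrite ?mul0r ?scale0r//.
  by case/imfsetP: tE; exists (t * h^-1)%g; rewrite ?mulgVK.
rewrite Mv; apply: eq_bigr => k _; rewrite !wE starM.
have [_ hh] := delta_unitary A h.
by rewrite -mulrA [d h * _]mulrA hh mul1r.
Qed.

(** Squares of combinations over E have their entries in S[E E^-1], which is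
what allows a sum of squares in C^*(G) to be read as an element of SOS(E). *)
Lemma sos_span n (E : finNonempty G) (M : 'M[A]_n) i j :
  sos_cone (val E) M -> M i j \in span_pred (A := A) (ratio_domain E).
Proof.
move=> /sos_coneP[K [v ->]]; apply: rpred_sum => k _.
rewrite lincomb_mul_star big_seq; apply: rpred_sum => s sE.
rewrite big_seq; apply: rpred_sum => t tE; apply: rpredZ; apply: delta_span.
by exists s => //; exists t.
Qed.

Section Trace.
Variable tau : {scalar A}.
Hypothesis tau_delta : forall s, tau (d s) = (s == 1%g)%:R.

(** The terms off the diagonal carry delta_(s t^-1) with s <> t, which the
trace kills. *)
Lemma tau_lincomb E w : tau (lincomb E w * star (lincomb E w)) = \sum_(s <- E) `|w s| ^+ 2.
Proof.
rewrite lincomb_mul_star linear_sum big_seq [RHS]big_seq; apply: eq_bigr => s sE.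
rewrite linear_sum (big_fsetD1 s)//= linearZ /= mulgV tau_delta eqxx mulr1 -normCK.
rewrite big_seq big1 ?addr0// => t; rewrite !inE => /andP[ts _].
by rewrite linearZ /= tau_delta divg_eq1 eq_sym (negPf ts) mulr0.
Qed.

Lemma tau_lincomb_ge0 E w : 0 <= tau (lincomb E w * star (lincomb E w)).
Proof. by rewrite tau_lincomb; apply: sumr_ge0 => s _; rewrite exprn_ge0. Qed.

Lemma tau_lincomb_eq0 E w : tau (lincomb E w * star (lincomb E w)) = 0 -> lincomb E w = 0.
Proof.
rewrite tau_lincomb => /eqP; rewrite psumr_eq0 => [/allP w0|s _]; last by rewrite exprn_ge0.
rewrite /lincomb big_seq big1// => s /w0 /=; rewrite sqrf_eq0 normr_eq0 => /eqP ->.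
by rewrite scale0r.
Qed.

Lemma sos_trace_ge0 n E (M : 'M[A]_n) :
  sos_cone E M -> 0 <= \sum_i tau (M i i).
Proof.
move=> /sos_coneP[K [v Mv]]; apply: sumr_ge0 => i _.
by rewrite Mv linear_sum; apply: sumr_ge0 => k _; exact: tau_lincomb_ge0.
Qed.

Lemma sos_trace_eq0 n E (M : 'M[A]_n) :
  sos_cone E M -> \sum_i tau (M i i) = 0 -> M = 0.
Proof.
move=> /sos_coneP[K [v Mv]].
under eq_bigr => i _ do rewrite Mv linear_sum.
move=> /psumr_eq0P t0.
have v0 k i : lincomb E (v k i) = 0.
  apply: tau_lincomb_eq0; move: k (isT : true); apply/psumr_eq0P => [k _|].
    exact: tau_lincomb_ge0.
  by apply: (t0 _ i) => // j _; apply: sumr_ge0 => k _; exact: tau_lincomb_ge0.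
by apply/matrixP => i j; rewrite Mv mxE big1// => k _; rewrite v0 mul0r.
Qed.

End Trace.

Lemma span_valD (D : posDomain G) (x y : spanS A D) :
  span_val (x + y) = span_val x + span_val y.
Proof. by []. Qed.

Lemma span_valZ (D : posDomain G) a (x : spanS A D) :
  span_val (a *: x) = a *: span_val x.
Proof. by []. Qed.

Lemma span_val_star (D : posDomain G) (x : spanS A D) :
  span_val (star x) = star (span_val x).
Proof. by []. Qed.

Lemma span_valMn (D : posDomain G) (x : spanS A D) m :
  span_val (x *+ m) = span_val x *+ m.
Proof. by elim: m => [|m IH] //; rewrite !mulrS span_valD IH. Qed.

(** * Order units *)

(** The argument is made for an arbitrary cone K that contains, for each g in
D, all the sums of squares of some E with g in E E^-1.  This covers SOS(E),
with one set E for all g, and UOS_0(D), with E = {1, g}. *)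
Section OrderUnit.
Variables (D : posDomain G) (n : nat).
Local Notation V := (spanS A D).
Variable K : set 'M[V]_n.
Hypothesis coneK : convex_cone K.
Hypothesis sosK : forall g, pd_set D g -> exists E, ratio_set E g /\
  forall X : 'M[V]_n, sos_cone E (map_mx (@span_val _ _ _ _) X) -> K X.

Local Notation unitV := (mxdiag_const n (spanS_unit A D)).

Definition dominated (X : 'M[V]_n) := exists2 r : R, 0 < r & K (mxscale r%:C unitV + X).

(** E_ab (x) y plus its adjoint. *)
Definition hermpair (a b : 'I_n) (y : V) : 'M[V]_n :=
  \matrix_(i, j) (y *+ ((i == a) && (j == b)) + star y *+ ((i == b) && (j == a))).

Lemma hermpairD a b y z : hermpair a b (y + z) = hermpair a b y + hermpair a b z.
Proof. by apply/matrixP => i j; rewrite !mxE starD !mulrnDl addrACA. Qed.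

(** For s in E, the square of sqrt(b_k) E_kk (x) delta_s is
b_k E_kk (x) 1. *)
Lemma diag_pos (b : 'I_n -> R) : (forall i, 0 <= b i) ->
  K (\matrix_(i, j) (((b i)%:C *: spanS_unit A D) *+ (i == j))).
Proof.
move=> b0; have [E [[s sE _] EK]] := sosK (pd_one D); apply: EK.
apply/sos_coneP.
exists 'I_n, (fun k i t => (t == s)%:R * ((i == k)%:R * (Num.sqrt (b k))%:C)) => i j.
rewrite (bigD1 i)//= big1 ?addr0 => [|k ki]; rewrite !lincomb1//; last first.
  by rewrite eq_sym (negPf ki) mul0r scale0r mul0r.
rewrite !mxE eqxx mul1r starZ star_delta -scalerAl -scalerAr scalerA -deltaM mulgV.
rewrite [j == i]eq_sym; case: eqP => [->|_] /=.
  by rewrite mul1r conj_Creal ?complex_real// -rmorphM -expr2 sqr_sqrtr ?mulr1n.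
by rewrite mul0r rmorph0 mulr0 scale0r.
Qed.

Lemma dominatedD X Y : dominated X -> dominated Y -> dominated (X + Y).
Proof.
have [_ KD _] := coneK.
move=> [r r0 KX] [s s0 KY]; exists (r + s); first exact: addr_gt0.
have -> : mxscale (r + s)%:C unitV + (X + Y) =
    (mxscale r%:C unitV + X) + (mxscale s%:C unitV + Y).
  by rewrite addrACA; congr (_ + _); apply/matrixP => i j; rewrite !mxE rmorphD scalerDl.
exact: KD.
Qed.

Lemma dominated0 : dominated 0.
Proof.
exists 1 => //; have := diag_pos (fun=> ler01).
congr K; apply/matrixP => i j; rewrite !mxE addr0.
by case: eqP; rewrite ?mulr1n// mulr0n scaler0.
Qed.

(** The square of the column c e_a (x) delta_s + e_b (x) delta_t, where
g = s t^-1, is hermpair a b (c delta_g) plus the diagonal matrix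
|c|^2 E_aa + E_bb; the latter is at most |c|^2 + 1. *)
Lemma dominated_delta a b (c : C) g (Dg : pd_set D g) :
  dominated (hermpair a b (c *: SpanS (delta_span A Dg))).
Proof.
have [_ KD _] := coneK.
have [E [[s sE [t tE stg]] EK]] := sosK Dg.
have [m hm] : exists m : R, `|c| ^+ 2 = m%:C by rewrite -add_Re2_Im2; eexists.
have m0 : 0 <= m by rewrite -ler0c -hm exprn_ge0.
exists (m + 1); first by rewrite ltr_wpDl.
pose y i : A := (i == a)%:R * c *: d s + (i == b)%:R *: d t.
pose N : 'M[V]_n := \matrix_(i, j) ((((m * (i == a)%:R + (i == b)%:R)%:C *: spanS_unit A D) *+ (i == j))).
have KN : K (N + hermpair a b (c *: SpanS (delta_span A Dg))).
  apply: EK; apply/sos_coneP.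
  exists unit, (fun=> fun i u => (u == s)%:R * ((i == a)%:R * c) + (u == t)%:R * (i == b)%:R) => i j.
  rewrite big_const card_unit /= addr0.
  have yE k : lincomb E (fun u => (u == s)%:R * ((k == a)%:R * c) + (u == t)%:R * (k == b)%:R) = y k.
    rewrite /y -(lincomb1 _ sE) -(lincomb1 _ tE) /lincomb -big_split /=; apply: eq_bigr => u _.
    by rewrite scalerDl.
  rewrite !yE !mxE.
  rewrite !span_valD !span_valMn span_val_star !span_valZ /= /y starD !starZ !star_delta.
  rewrite mulrDl !mulrDr -!scalerAl -!scalerAr !scalerA -!deltaM !mulgV stg.
  have -> : (t / s)%g = g^-1%g by rewrite -stg invgM invgK.
  rewrite !rmorphM !rmorph_nat /= delta1.
  have -> : (m * (i == a)%:R + (i == b)%:R)%:C%:A *+ (i == j) =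
      ((i == a)%:R * c * ((j == a)%:R * c^*))%:A + ((i == b)%:R * (j == b)%:R)%:A :> A.
    rewrite -scalerDl mulrACA -normCK hm rmorphD rmorphM !rmorph_nat.
    have [<-|ij] := eqVneq i j; rewrite ?mulr1n ?mulr0n.
      congr (_ *: _); case: (i == a); case: (i == b);
        by rewrite ?(mulr0, mul0r, mulr1, mul1r).
    have [ia|] := eqVneq i a; have [ib|] := eqVneq i b;
      rewrite -?ia -?ib ?[j == i]eq_sym ?(negPf ij) ?(mulr0, mul0r, addr0, add0r) ?scale0r //.
  have -> : ((i == a)%:R * c * (j == b)%:R) *: d g = c *: d g *+ ((i == a) && (j == b)).
    by case: (i == a); case: (j == b); rewrite ?(mul0r, mulr0, mul1r, mulr1) ?scale0r.
  have -> : ((i == b)%:R * ((j == a)%:R * c^*)) *: d g^-1%g =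
      c^* *: d g^-1%g *+ ((i == b) && (j == a)).
    by case: (i == b); case: (j == a); rewrite ?(mul0r, mulr0, mul1r, mulr1) ?scale0r.
  by rewrite addrACA; congr (_ + _); exact: addrC.
(* the diagonal part of m + 1 that the square N + hermpair leaves over *)
pose b' i := m + 1 - m * (i == a)%:R - (i == b)%:R.
have b'0 i : 0 <= b' i.
  by rewrite /b'; case: (i == a); case: (i == b); rewrite /=; lra.
have := KD _ _ (diag_pos b'0) KN; congr K; rewrite addrA; congr (_ + _).
apply/matrixP => i j; rewrite !mxE -mulrnDl -scalerDl -rmorphD -scalerMnr.
by rewrite (_ : m + 1 = b' i + (m * (i == a)%:R + (i == b)%:R)) // /b'; ring.
Qed.

(** The elements y for which the claim holds are closed under sums, so it is
enough to peel off the terms of a representation of y. *)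
Lemma dominated_hermpair a b y : dominated (hermpair a b y).
Proof.
have /span_predP[l] := span_valP y.
elim: l y => [|[c g] l IH] y lD yE.
  have -> : y = 0 by apply: val_inj; rewrite /= yE big_nil.
  rewrite (_ : hermpair a b 0 = 0); first exact: dominated0.
  by apply/matrixP => i j; rewrite !mxE star0 !mul0rn addr0.
have Dg : pd_set D g by apply: (lD (c, g)); exact: mem_head.
rewrite -[y](subrKC (c *: SpanS (delta_span A Dg))) hermpairD.
apply: dominatedD; first exact: dominated_delta.
apply: IH => [p pl|]; first by apply: lD; rewrite inE pl orbT.
by rewrite /= yE big_cons addrC addKr.
Qed.

(** A hermitian X is the sum over a, b of hermpair a b (X_ab / 2). *)
Lemma order_unit_of_sos X : hermitian_mx X -> dominated X.
Proof.
move=> /matrixP hX.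
have -> : X = \sum_a \sum_b hermpair a b (2^-1 *: X a b).
  apply/matrixP => i j; rewrite summxE.
  under eq_bigr => a _ do rewrite summxE.
  under eq_bigr => a _ do under eq_bigr => b _ do rewrite mxE.
  have pick (F : 'I_n -> 'I_n -> V) k l :
      \sum_a \sum_b F a b *+ ((k == a) && (l == b)) = F k l.
    rewrite (bigD1 k)//= [X in _ + X]big1 ?addr0 => [|a ak]; last first.
      by rewrite big1// => b _; rewrite eq_sym (negPf ak) mulr0n.
    rewrite (bigD1 l)//= !eqxx mulr1n big1 ?addr0// => b bl.
    by rewrite [l == b]eq_sym (negPf bl) andbF mulr0n.
  under eq_bigr => a _ do rewrite big_split.
  rewrite big_split /= pick.
  under [X in _ + X]eq_bigr => a _ do under eq_bigr => b _ do rewrite andbC.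
  rewrite (pick (fun a b => star (2^-1 *: X a b)) j i) starZ.
  have -> : star (X j i) = X i j by have := hX i j; rewrite mxE.
  have -> : ((2^-1 : C)^* = 2^-1) by rewrite fmorphV rmorph_nat.
  by rewrite -scalerDl -[X in X + X]mul1r -splitr scale1r.
by elim/big_ind: _ => [|Y Z|a _]; [exact: dominated0|exact: dominatedD|];
  elim/big_ind: _ => [|Y Z|b _]; [exact: dominated0|exact: dominatedD|exact: dominated_hermpair].
Qed.

End OrderUnit.

End GroupAlgebra.

(** * Gram matrices and closedness of the cones of sums of squares *)

Section Gram.
Variables (R : realType) (J : finType).
Local Notation C := R[i].
Implicit Types (P : J -> J -> C).

Definition is_gram P := exists (K : finType) (v : K -> J -> C),
  forall x y, P x y = \sum_k v k x * (v k y)^*.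

Definition is_psd P := (forall x y, P y x = (P x y)^*) /\
  forall w : J -> C, 0 <= \sum_x \sum_y w x * P x y * (w y)^*.

Lemma gram_psd P : is_gram P -> is_psd P.
Proof.
move=> [K [v Pv]]; split=> [x y|w].
  rewrite !Pv rmorph_sum; apply: eq_bigr => k _.
  by rewrite rmorphM /= conjCK mulrC.
have -> : \sum_x \sum_y w x * P x y * (w y)^* =
    \sum_k (\sum_x w x * v k x) * (\sum_x w x * v k x)^*.
  under eq_bigr => x _ do under eq_bigr => y _ do rewrite Pv mulr_sumr mulr_suml.
  under eq_bigr => x _ do rewrite exchange_big.
  rewrite exchange_big; apply: eq_bigr => k _ /=.
  rewrite mulr_suml; apply: eq_bigr => x _.
  rewrite rmorph_sum mulr_sumr; apply: eq_bigr => y _.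
  by rewrite rmorphM /=; ring.
by apply: sumr_ge0 => k _; rewrite -normCK exprn_ge0.
Qed.

Lemma gram_norm_le P x y : is_gram P -> `|P x y| <= P x x + P y y.
Proof.
move=> [K [v Pv]]; rewrite !Pv -big_split (le_trans (ler_norm_sum _ _ _))//.
apply: ler_sum => k _; rewrite normrM norm_conjC -!normCK /=.
rewrite -subr_ge0; set a := `|v k x|; set b := `|v k y|.
have -> : a ^+ 2 + b ^+ 2 - a * b = 2^-1 * (a ^+ 2 + b ^+ 2 + (a - b) ^+ 2).
  by field.
apply: mulr_ge0; rewrite ?invr_ge0//; apply: addr_ge0.
  by rewrite addr_ge0 ?exprn_ge0 ?normr_ge0.
by rewrite real_exprn_even_ge0// realB ?normr_real.
Qed.

Lemma gram_diag_ge0 P x : is_gram P -> 0 <= P x x.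
Proof.
by move=> [K [v ->]]; apply: sumr_ge0 => k _; rewrite -normCK exprn_ge0.
Qed.

(** Diagonalize P = U^* D U with U unitary; the eigenvalues are values of
the form at the rows of U, hence nonnegative, and the conjugates of the rows
of sqrt(D) U are the vectors. *)
Lemma psd_gram P : is_psd P -> is_gram P.
Proof.
move=> [Ph Pp].
pose M : 'M[C]_#|J| := \matrix_(i, j) P (enum_val i) (enum_val j).
have Mh : M \is hermsymmx.
  apply/is_hermitianmxP; rewrite expr0 scale1r; apply/matrixP => i j.
  by rewrite !mxE Ph.
have /orthomx_spectralP := hermitian_normalmx Mh.
set U := spectralmx M; set Ua := map_mx Num.conj U^T; set D := spectral_diag M.
have Uu : U \is unitarymx := spectral_unitarymx M.
rewrite invmx_unitary// -/Ua => ME.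
have ME2 i j : M i j = \sum_k D 0 k * ((U k i)^* * U k j).
  rewrite [LHS](congr1 (fun N : 'M[C]_#|J| => N i j) ME) mxE; apply: eq_bigr => k _.
  rewrite mul_mx_diag !mxE; ring.
have UU : U *m Ua = 1%:M by apply/unitarymxP.
have D0 k : 0 <= D 0 k.
  have := Pp (fun x => U k (enum_rank x)).
  have -> : \sum_x \sum_y U k (enum_rank x) * P x y * (U k (enum_rank y))^* =
      (U *m M *m Ua) k k.
    rewrite mxE; under [RHS]eq_bigr => j _ do rewrite !mxE mulr_suml.
    rewrite exchange_big (reindex_onto enum_val enum_rank) /=; last first.
      by move=> x _; rewrite enum_rankK.
    under eq_bigl => x do rewrite enum_valK eqxx.
    apply: eq_bigr => i _; rewrite (reindex_onto enum_val enum_rank) /=; last first.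
      by move=> x _; rewrite enum_rankK.
    under eq_bigl => x do rewrite enum_valK eqxx.
    by apply: eq_bigr => j _; rewrite !enum_valK mxE.
  rewrite [in X in 0 <= X -> _]ME !mulmxA UU mul1mx -mulmxA UU mulmx1.
  by rewrite mxE eqxx mulr1n.
exists 'I_#|J|, (fun k x => sqrtC (D 0 k) * (U k (enum_rank x))^*) => x y.
have := ME2 (enum_rank x) (enum_rank y); rewrite mxE !enum_rankK => ->.
apply: eq_bigr => k _; rewrite rmorphM /= conjCK.
rewrite (geC0_conj (_ : 0 <= sqrtC (D 0 k))) ?sqrtC_ge0// mulrACA -expr2 sqrtCK.
by [].
Qed.

(** Being a Gram matrix is a closed condition because positive
semidefiniteness is; the number of vectors may vary along F. *)
Lemma gram_limit T (F : set_system T) {FF : ProperFilter F} (Q : T -> J -> J -> C) P :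
  (forall t, is_gram (Q t)) ->
  (forall x y, ((fun t => Q t x y) : T -> C^o) @ F --> (P x y : C^o)) ->
  is_gram P.
Proof.
move=> Qg QP; apply: psd_gram; split=> [x y|w].
  have h : ((fun t => (Q t x y)^*) : T -> C^o) @ F --> ((P x y)^* : C^o).
    exact: cvg_conj.
  have QyxE : (fun t => Q t y x) = (fun t => (Q t x y)^*).
    by apply/funext => t; have [-> _] := gram_psd (Qg t).
  have h' := QP y x; rewrite QyxE in h'.
  exact: (cvg_unique (@norm_hausdorff _ C^o) h' h).
pose q t : C := \sum_x \sum_y w x * Q t x y * (w y)^*.
have q0 : \forall t \near F, 0 <= q t.
  by apply: filterE => t; have [_] := gram_psd (Qg t); apply.
apply: cvg_ge0 q0 _; apply: cvgC_sum => x; apply: cvgC_sum => y.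
apply: cvgC_mul; last exact: cvg_cst.
exact: cvgC_mull (QP x y).
Qed.

End Gram.

(** By maximality of F, for each set B either B or its complement has
preimage in F. *)
Lemma ultra_fmap T T' (F : set_system T) (u : T -> T') :
  UltraFilter F -> UltraFilter (u @ F).
Proof.
move=> UF; have PF : ProperFilter F by exact: ultra_proper.
apply: Build_UltraFilter => H PH FH; apply/seteqP; split=> // B HB.
have [//|FB] := in_ultra_setVsetC (u @^-1` B) UF.
have := filter_ex (filterI HB (FH (~` B) FB)).
by case=> x [].
Qed.

(** Convergence along one ultrafilter replaces the extraction of
subsequences, once for each matrix entry. *)
Lemma ultra_bounded_cvg (R : realType) T (F : set_system T) (UF : UltraFilter F)
    (u : T -> R[i]) (B : R) :
  (forall t, `|u t| <= B%:C) -> exists l : R[i], (u : T -> R[i]^o) @ F --> (l : R[i]^o).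
Proof.
move=> uB; have PF : ProperFilter F by exact: ultra_proper.
have part (p : R[i] -> R) : (forall z, `|p z|%:C <= `|z|) ->
    exists l : R, p (u t) @[t --> F] --> l.
  move=> pn.
  have [] := @segment_compact R (- B) B ((p \o u) @ F) _ _.
    have : \forall t \near F, `[- B, B]%classic (p (u t)); last exact.
    apply: filterE => t /=; rewrite in_itv /= -ler_norml -lecR.
    exact: le_trans (pn _) (uB t).
  have UpF := ultra_fmap (p \o u) UF.
  by move=> l [_]; rewrite ultra_cvg_clusterE; exists l.
have [a ha] := part _ (@normc_ge_Re R).
have [b hb] := part _ (@normc_ge_Im R).
by exists (a +i* b); exact: cvg_ReIm.
Qed.

Section SosClosed.
Variables (R : realType) (G : groupType) (A : groupCstar R G).
Local Notation C := R[i].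
Local Notation d := (delta A).

(** The linear map from matrices indexed by {1, .., n} x E to M_n(C^*(G))
that sends positive semidefinite matrices to sums of squares. *)
Definition gram_sum n (E : {fset G})
    (P : 'I_n * E -> 'I_n * E -> C) (i j : 'I_n) : A :=
  \sum_(s : E) \sum_(t : E) P (i, s) (j, t) *: d (fsval s * (fsval t)^-1)%g.

Lemma sos_gramP n E (M : 'M[A]_n) : sos_cone E M <->
  exists2 P : 'I_n * E -> 'I_n * E -> C, is_gram P & forall i j, M i j = gram_sum P i j.
Proof.
have key (K : finType) (v : K -> 'I_n -> G -> C) i j :
    \sum_k lincomb A E (v k i) * star (lincomb A E (v k j)) =
    gram_sum (fun x y : 'I_n * E => \sum_k v k x.1 (fsval x.2) * (v k y.1 (fsval y.2))^*) i j.
  under eq_bigr => k _ do rewrite lincomb_mul_star big_seq_fsetE.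
  rewrite exchange_big /=; apply: eq_bigr => s _.
  under eq_bigr => k _ do rewrite big_seq_fsetE.
  by rewrite exchange_big /=; apply: eq_bigr => t _; rewrite scaler_suml.
split.
  move=> /sos_coneP[K [v Mv]].
  exists (fun x y : 'I_n * E => \sum_k v k x.1 (fsval x.2) * (v k y.1 (fsval y.2))^*).
    by exists K, (fun k x => v k x.1 (fsval x.2)).
  by move=> i j; rewrite Mv key.
move=> [P [K [v Pv]] Mv]; apply/sos_coneP.
pose w k i s : C := if insub s is Some s' then v k (i, s') else 0.
exists K, w => i j.
rewrite (key _ w) Mv; apply: eq_bigr => s _; apply: eq_bigr => t _.
by rewrite Pv; congr (_ *: _); apply: eq_bigr => k _; rewrite /w !valK.
Qed.

Lemma fourier_gram_sum (tau : {scalar A}) n (E : {fset G})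
    (P : 'I_n * E -> 'I_n * E -> C) i j g :
  (forall s, tau (d s) = (s == 1%g)%:R) ->
  fourier tau (gram_sum P i j) g = \sum_(s : E) \sum_(t : E)
      P (i, s) (j, t) * (fsval s * (fsval t)^-1 == g)%g%:R.
Proof.
move=> td; rewrite fourier_sum; apply: eq_bigr => s _.
by rewrite fourier_sum; apply: eq_bigr => t _; rewrite fourierZ fourier_delta.
Qed.

(** For r = 1 / (k + 1) take a Gram matrix Q k of r + M.  Its trace is the
trace of r + M, so all its entries are bounded independently of k.  A limit P
along an ultrafilter is a Gram matrix, and comparing Fourier coefficients in
the limit gives M = gram_sum P. *)
Lemma sos_closed (E : finNonempty G) n (M : 'M[A]_n) :
  (forall i j, M i j \in span_pred (ratio_domain E)) ->
  (forall r : R, 0 < r -> sos_cone (val E) (mxscale r%:C (mxdiag_const n 1) + M)) ->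
  sos_cone (val E) M.
Proof.
move=> Mspan Mr; have [tau [tau_delta _]] := canonical_trace A.
pose e k : R := k.+1%:R^-1.
have /choice[Q hQ] k : exists Q : 'I_n * val E -> 'I_n * val E -> C, is_gram Q /\
    forall i j, (mxscale (e k)%:C (mxdiag_const n 1) + M) i j = gram_sum Q i j.
  have : sos_cone (val E) (mxscale (e k)%:C (mxdiag_const n 1) + M).
    by apply: Mr; rewrite invr_gt0.
  by move=> /sos_gramP[Q Qg QM]; exists Q.
have fourierQ k i j g : (e k)%:C * (i == j)%:R * (g == 1)%g%:R + fourier tau (M i j) g =
    \sum_(s : val E) \sum_(t : val E)
      Q k (i, s) (j, t) * (fsval s * (fsval t)^-1 == g)%g%:R.
  have [_ /(_ i j)] := hQ k; rewrite !mxE => /(congr1 (fun x => fourier tau x g)).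
  rewrite fourier_gram_sum// => <-; rewrite fourierD -[_%:R in RHS]scaler_nat scalerA fourierZ.
  by rewrite -(delta1 A) fourier_delta// [g == _]eq_sym.
pose c := \sum_i fourier tau (M i i) 1%g.
have [b hb] : exists b : R, `|c| = b%:C by rewrite normc_def; eexists.
have Qbound k x y : `|Q k x y| <= ((n%:R + b) + (n%:R + b))%:C.
  have [Qg _] := hQ k.
  have trQ : \sum_x Q k x x = (e k)%:C * n%:R + c.
    transitivity (\sum_i \sum_s Q k (i, s) (i, s)).
      by rewrite pair_bigA; apply: eq_bigr => -[].
    rewrite /c.
    have -> : (e k)%:C * n%:R = \sum_(i < n) (e k)%:C * (i == i)%:R * (1 == 1 :> G)%g%:R.
      by under eq_bigr => i _ do rewrite !eqxx !mulr1; rewrite sumr_const card_ord mulr_natr.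
    rewrite -big_split /=; apply: eq_bigr => i _; rewrite fourierQ; apply: eq_bigr => s _.
    rewrite (bigD1 s)//= mulgV eqxx mulr1 big1 ?addr0// => t ts.
    by rewrite divg_eq1 (inj_eq val_inj) eq_sym (negPf ts) mulr0.
  have Qle z : Q k z z <= (n%:R + b)%:C.
    apply: le_trans (_ : \sum_x Q k x x <= _).
      rewrite (bigD1 z)//= lerDl sumr_ge0// => x' _; exact: gram_diag_ge0.
    rewrite -[leLHS]ger0_norm; last by apply: sumr_ge0 => x' _; exact: gram_diag_ge0.
    rewrite trQ rmorphD rmorph_nat (le_trans (ler_normD _ _))// hb lerD//.
    rewrite ger0_norm ?mulr_ge0 ?ler0c ?invr_ge0// -[leRHS]mul1r ler_wpM2r//.
    by rewrite lecR invf_le1// ler1n.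
  by rewrite (le_trans (gram_norm_le _ _ Qg))// rmorphD lerD.
(* any ultrafilter on the indices k containing the neighbourhoods of infinity *)
have [U [UU evU]] := ultraFilterLemma eventually_filter.
have PU : ProperFilter U by exact: ultra_proper.
have /choice[P1 hP1] (xy : ('I_n * val E) * ('I_n * val E)) : exists l : C,
    ((fun k => Q k xy.1 xy.2) : nat -> C^o) @ U --> (l : C^o).
  exact: ultra_bounded_cvg (fun k => Qbound k xy.1 xy.2).
pose P x y := P1 (x, y).
have QP x y : ((fun k => Q k x y) : nat -> C^o) @ U --> (P x y : C^o).
  exact: (hP1 (x, y)).
have e0 : ((fun k => (e k)%:C) : nat -> C^o) @ U --> (0 : C^o).
  apply: (cvg_trans (G := ((fun k => (e k)%:C) : nat -> C^o) @ \oo)).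
    by move=> B; exact: evU.
  by apply: cvg_ReIm => /=; [exact: cvg_harmonic | exact: cvg_cst].
apply/sos_gramP; exists P.
  by apply: (@gram_limit _ _ _ U _ Q) => // k; have [] := hQ k.
move=> i j; apply/eqP; rewrite -subr_eq0; apply/eqP.
have : M i j - gram_sum P i j \in span_pred (ratio_domain E).
  rewrite rpredB//; apply: rpred_sum => s _; apply: rpred_sum => t _.
  apply: rpredZ; apply: delta_span; exists (fsval s); first exact: fsvalP.
  by exists (fsval t); first exact: fsvalP.
move=> /span_predP /fourier_eq0; apply; first exact: tau_delta.
move=> g; rewrite fourierD -scaleN1r fourierZ mulN1r fourier_gram_sum//.
apply/eqP; rewrite subr_eq0; apply/eqP.
have lim1 : ((fun k => \sum_(s : val E) \sum_(t : val E)
      Q k (i, s) (j, t) * (fsval s * (fsval t)^-1 == g)%g%:R) : nat -> C^o) @ U -->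
    (\sum_(s : val E) \sum_(t : val E)
      P (i, s) (j, t) * (fsval s * (fsval t)^-1 == g)%g%:R : C^o).
  apply: cvgC_sum => s; apply: cvgC_sum => t.
  by apply: cvgC_mul; [exact: QP | exact: cvg_cst].
have lim2 : ((fun k => (e k)%:C * (i == j)%:R * (g == 1)%g%:R + fourier tau (M i j) g)
    : nat -> C^o) @ U --> (0 * (i == j)%:R * (g == 1)%g%:R + fourier tau (M i j) g : C^o).
  apply: cvgC_add; last exact: cvg_cst.
  apply: cvgC_mul; last exact: cvg_cst.
  by apply: cvgC_mul; [exact: e0 | exact: cvg_cst].
rewrite !mul0r add0r in lim2.
have limE := funext (fun k => fourierQ k i j g); rewrite limE in lim2.
exact: (cvg_unique (@norm_hausdorff _ C^o) lim2 lim1).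
Qed.

End SosClosed.

(** * The Archimedeanisation of a matrix order unit space *)

Lemma ge0_of_perturb (R : realType) (c z : R[i]) : 0 <= c ->
  (forall r : R, 0 < r -> 0 <= r%:C * c + z) -> 0 <= z.
Proof.
case: c z => [a a'] [b b']; rewrite lecE /= => /andP[/eqP -> a0] h.
have := h 1 ltr01; rewrite lecE /= !mul0r !mulr0 !addr0 add0r => /andP[/eqP b'0 _].
rewrite lecE /= b'0 eqxx /=; apply/ler_addgt0Pl => e e0.
have a1 : 0 < a + 1 by rewrite ltr_wpDl.
have := h (e / (a + 1)) (divr_gt0 e0 a1).
rewrite lecE /= => /andP[_]; rewrite mul0r subr0 => /le_trans; apply.
rewrite lerD2r -[leRHS]mulr1 -mulrA ler_pM2l// ler_pdivrMl// mulr1.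
by rewrite lerDl.
Qed.

(** Polarization: evaluate at e_i + c e_j for c = 1 and c = i. *)
Lemma sesqui_form_eq0 (R : realType) (I : finType) (F : I -> I -> R[i]) :
  (forall w : I -> R[i], \sum_k \sum_l (w k * (w l)^*) * F k l = 0) ->
  forall k l, F k l = 0.
Proof.
move=> F0.
have key i j (c : R[i]) : F i i + c * c^* * F j j + c^* * F i j + c * F j i = 0.
  rewrite -[RHS](F0 (fun k => (k == i)%:R + c * (k == j)%:R)).
  have pick k (H : I -> R[i]) : \sum_l (l == k)%:R * H l = H k.
    rewrite (bigD1 k)//= eqxx mul1r big1 ?addr0// => l /negPf ->.
    by rewrite mul0r.
  have ev a (H : I -> R[i]) :
      \sum_l ((l == i)%:R + a * (l == j)%:R) * H l = H i + a * H j.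
    under eq_bigr => l _ do rewrite mulrDl -mulrA.
    by rewrite big_split -mulr_sumr /= !pick.
  under eq_bigr => k _.
    under eq_bigr => l _ do rewrite -mulrA rmorphD rmorphM /= !rmorph_nat.
    rewrite -mulr_sumr ev.
    over.
  by rewrite ev; ring.
have diag0 i : F i i = 0 by have := key i i 0; rewrite conjC0 !mul0r !addr0.
move=> i j; have := key i j 1; have := key i j 'i.
rewrite !diag0 conjC1 conjCi !mulr0 !add0r !mul1r => hi /eqP.
rewrite addrC addr_eq0 => /eqP h1; move: hi; rewrite h1 mulrN mulNr -opprD => /eqP.
rewrite oppr_eq0 -mulrDl mulf_eq0 => /orP[|/eqP //].
by rewrite -mulr2n mulrn_eq0 /= (negPf (neq0Ci _)).
Qed.

Section MatrixScaling.
Variables (R : realType) (V W : starLmodType R).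
Local Notation C := R[i].

Lemma mxscaleDr m n (a : C) (X Y : 'M[V]_(m, n)) :
  mxscale a (X + Y) = mxscale a X + mxscale a Y.
Proof. by apply/matrixP => i j; rewrite !mxE scalerDr. Qed.

Lemma mxscaleDl m n (a b : C) (X : 'M[V]_(m, n)) :
  mxscale (a + b) X = mxscale a X + mxscale b X.
Proof. by apply/matrixP => i j; rewrite !mxE scalerDl. Qed.

Lemma mxscaleA m n (a b : C) (X : 'M[V]_(m, n)) :
  mxscale a (mxscale b X) = mxscale (a * b) X.
Proof. by apply/matrixP => i j; rewrite !mxE scalerA. Qed.

Lemma mxscale1 m n (X : 'M[V]_(m, n)) : mxscale 1 X = X.
Proof. by apply/matrixP => i j; rewrite !mxE scale1r. Qed.

Lemma mxscaleN m n (a : C) (X : 'M[V]_(m, n)) : mxscale a (- X) = - mxscale a X.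
Proof. by apply/matrixP => i j; rewrite !mxE scalerN. Qed.

Lemma mxcompressD n m (alpha : 'M[C]_(n, m)) (X Y : 'M[V]_m) :
  mxcompress alpha (X + Y) = mxcompress alpha X + mxcompress alpha Y.
Proof.
apply/matrixP => i j; rewrite !mxE -big_split; apply: eq_bigr => k _.
by rewrite -big_split; apply: eq_bigr => l _; rewrite mxE scalerDr.
Qed.

Lemma mxcompressZ n m (alpha : 'M[C]_(n, m)) a (X : 'M[V]_m) :
  mxcompress alpha (mxscale a X) = mxscale a (mxcompress alpha X).
Proof.
apply/matrixP => i j; rewrite !mxE scaler_sumr; apply: eq_bigr => k _.
rewrite scaler_sumr; apply: eq_bigr => l _.
by rewrite mxE !scalerA mulrC.
Qed.

Lemma mxstar_compress n m (alpha : 'M[C]_(n, m)) (X : 'M[V]_m) :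
  mxstar (mxcompress alpha X) = mxcompress alpha (mxstar X).
Proof.
apply/matrixP => i j; rewrite !mxE star_sum exchange_big; apply: eq_bigr => k _ /=.
rewrite star_sum; apply: eq_bigr => l _.
by rewrite starZ mxE rmorphM /= conjCK mulrC.
Qed.

Variable f : {linear V -> W}.

Lemma map_mxscale m n a (X : 'M[V]_(m, n)) :
  map_mx f (mxscale a X) = mxscale a (map_mx f X).
Proof. by apply/matrixP => i j; rewrite !mxE linearZ. Qed.

Lemma map_mxcompress n m (alpha : 'M[C]_(n, m)) (X : 'M[V]_m) :
  map_mx f (mxcompress alpha X) = mxcompress alpha (map_mx f X).
Proof.
apply/matrixP => i j; rewrite !mxE linear_sum; apply: eq_bigr => k _.
by rewrite linear_sum; apply: eq_bigr => l _; rewrite linearZ /= mxE.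
Qed.

Lemma map_mxdiag_const n e : map_mx f (mxdiag_const n e) = mxdiag_const n (f e).
Proof. by apply/matrixP => i j; rewrite !mxE raddfMn. Qed.

End MatrixScaling.

Section MatrixOrderUnit.
Variables (R : realType) (X : mouData R).
Hypothesis hX : is_matrix_order_unit_space X.
Local Notation C := R[i].

Lemma mou_posD n (x y : 'M[X]_n) : mou_pos x -> mou_pos y -> mou_pos (x + y).
Proof. by have [_ h _] := mou_cone hX n; exact: h. Qed.

Lemma mou_posZ n (r : R) (x : 'M[X]_n) :
  0 <= r -> mou_pos x -> mou_pos (mxscale r%:C x).
Proof. by have [_ _ h] := mou_cone hX n; exact: h. Qed.

Lemma mou_pos_unit n (r : R) : 0 <= r -> mou_pos (mxscale r%:C (mou_unit_mx X n)).
Proof.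
move=> r0; have [s s0] := mou_order_unit hX (mxstar0 X n n).
rewrite addr0 => h.
have -> : mxscale r%:C (mou_unit_mx X n) =
    mxscale (r / s)%:C (mxscale s%:C (mou_unit_mx X n)).
  by rewrite mxscaleA -rmorphM mulfVK ?gt_eqF.
by apply: mou_posZ => //; rewrite divr_ge0// ltW.
Qed.

Local Notation pr := (@arch_proj R X).
Local Notation ppr := (map_mx pr).

(** Positivity of the class of x can be tested on any representative, not
only on the one named in the definition of the cone. *)
Lemma arch_posP n (x : 'M[X]_n) : @arch_pos R X n (ppr x) <->
  forall r : R, 0 < r ->
    exists2 p, mou_pos p & ppr p = ppr (mxscale r%:C (mou_unit_mx X n) + x).
Proof.
split=> [[y hy yx] r /hy[p pp E]|h]; last by exists x.
by exists p => //; rewrite E !map_mxD yx.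
Qed.

Lemma arch_proj_mx_surj n (q : 'M[arch X]_n) : exists x, ppr x = q.
Proof.
exists (map_mx (fun y => repr y) q); apply/matrixP => i j; rewrite !mxE.
exact: arch_proj_repr.
Qed.

Lemma arch_pos_proj n (x : 'M[X]_n) : mou_pos x -> mou_pos (ppr x : 'M[arch X]_n).
Proof.
move=> px; apply/arch_posP => r r0; exists (mxscale r%:C (mou_unit_mx X n) + x) => //.
by apply: mou_posD => //; apply: mou_pos_unit; rewrite ltW.
Qed.

Lemma arch_proj_mx_unit n : ppr (mou_unit_mx X n) = mou_unit_mx (arch X) n.
Proof. exact: map_mxdiag_const. Qed.

(** The hermitian part of any lift. *)
Lemma hermitian_lift n (q : 'M[arch X]_n) : hermitian_mx q ->
  exists2 x : 'M[X]_n, hermitian_mx x & ppr x = q.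
Proof.
have [x <-] := arch_proj_mx_surj q; rewrite /hermitian_mx mxstar_arch_proj => hx.
exists (mxscale (2^-1)%:C (x + mxstar x)).
  rewrite /hermitian_mx mxstarZr mxstarD addrC; congr (mxscale _ (_ + _)).
  by apply/matrixP => i j; rewrite !mxE starK.
rewrite map_mxscale map_mxD /= hx mxscaleDr -mxscaleDl -rmorphD.
by rewrite -[X in X + X]mul1r -splitr mxscale1.
Qed.

(** A state takes equal values on x and y when their classes agree, so it is
positive on each w p w^* with p positive and class that of r + x; let r
tend to 0. *)
Lemma state_compress_ge0 n (x : 'M[X]_n) (f : {scalar X}) (w : 'I_n -> C) :
  is_state f -> mou_pos (ppr x : 'M[arch X]_n) ->
  0 <= \sum_k \sum_l (w k * (w l)^*) * f (x k l).
Proof.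
move=> fs /arch_posP hx; have [f1 fp] := fs.
pose c := \sum_k w k * (w k)^*.
have c0 : 0 <= c by apply: sumr_ge0 => k _; rewrite -normCK exprn_ge0.
apply: (ge0_of_perturb c0) => r /hx[p pp E].
pose alpha : 'M[C]_(1, n) := \row_k w k.
have := mou_compatible hX alpha pp.
have -> : mxcompress alpha p = const_mx (\sum_k \sum_l (w k * (w l)^*) *: p k l).
  apply/matrixP => i j; rewrite !mxE; apply: eq_bigr => k _.
  by apply: eq_bigr => l _; rewrite !mxE.
move=> /fp; congr (0 <= _).
rewrite linear_sum /c mulr_sumr -big_split; apply: eq_bigr => k _.
have fpE l : f (p k l) = r%:C * (k == l)%:R + f (x k l).
  have /matrixP /(_ k l) := E; rewrite !mxE => /arch_projP/null_predP/(_ f fs).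
  move=> /eqP; rewrite raddfB subr_eq0 => /eqP ->.
  rewrite raddfD /= linearZ /=; congr (_ * _ + _).
  by case: (k == l); rewrite ?mulr1n ?f1// mulr0n raddf0.
rewrite linear_sum; under eq_bigr => l _ do rewrite linearZ /= fpE mulrDr.
rewrite big_split; congr (_ + _); rewrite (bigD1 k)//= eqxx big1 ?addr0 => [|l lk].
  by rewrite mulr1 mulrC.
by rewrite eq_sym (negPf lk) !mulr0.
Qed.

(** If the classes of x and -x are positive, all states vanish on each
w x w^*, hence by polarization on each entry of x.  For compression by alpha,
alpha (r + x) alpha^* differs from r + alpha x alpha^* by a multiple of
alpha alpha^* (x) e, which is dominated by a multiple of the unit. *)
Theorem arch_operator_system : is_operator_system (arch X).
Proof.
split; first split.
- move=> n; split.
  + by have := arch_pos_proj (let: And3 h _ _ := mou_cone hX n in h); rewrite map_mx0.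
  + move=> p q; have [x <-] := arch_proj_mx_surj p; have [y <-] := arch_proj_mx_surj q.
    move=> /arch_posP hx /arch_posP hy; rewrite -map_mxD; apply/arch_posP => r r0.
    have r2 : 0 < r / 2 by rewrite divr_gt0.
    have [a pa Ea] := hx _ r2; have [b pb Eb] := hy _ r2.
    exists (a + b); first exact: mou_posD.
    rewrite !map_mxD Ea Eb !map_mxD addrACA; congr (_ + _).
    by rewrite -map_mxD -mxscaleDl -rmorphD -splitr.
  + move=> r p; have [x <-] := arch_proj_mx_surj p.
    rewrite le_eqVlt => /predU1P[<- _|r0 /arch_posP hx].
      rewrite -map_mxscale; have := arch_pos_proj (mou_pos_unit n (lexx 0)).
      by congr (mou_pos (map_mx _ _)); apply/matrixP => i j; rewrite !mxE !scale0r.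
    rewrite -map_mxscale; apply/arch_posP => s s0.
    have [a pa Ea] := hx _ (divr_gt0 s0 r0).
    exists (mxscale r%:C a); first by apply: mou_posZ => //; exact: ltW.
    rewrite map_mxscale Ea -map_mxscale mxscaleDr mxscaleA -rmorphM mulrC mulfVK//.
    by rewrite gt_eqF.
- move=> n q; have [x <-] := arch_proj_mx_surj q => hx.
  rewrite -map_mxN => hNx; apply/matrixP => i j; rewrite !mxE.
  rewrite -[RHS]/(0 : arch_quot X) -[RHS](raddf0 pr); apply/arch_projP.
  rewrite subr0; apply/null_predP => f fs.
  apply: (sesqui_form_eq0 (F := fun k l => f (x k l))) => w; apply: le_anti.
  rewrite (state_compress_ge0 w fs hx) andbT -oppr_ge0.
  have := state_compress_ge0 w fs hNx; congr (0 <= _).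
  rewrite -sumrN; apply: eq_bigr => k _; rewrite -sumrN; apply: eq_bigr => l _.
  by rewrite mxE raddfN mulrN.
- move=> n q hq; have [x xh <-] := hermitian_lift hq.
  have [r r0 pr_] := mou_order_unit hX xh.
  exists (ppr (mxscale r%:C (mou_unit_mx X n) + x)), (ppr (mxscale r%:C (mou_unit_mx X n))).
  split; [exact: arch_pos_proj | apply: arch_pos_proj; exact/mou_pos_unit/ltW |].
  by rewrite map_mxD addrAC subrr add0r.
- move=> m n alpha q; have [x <-] := arch_proj_mx_surj q => /arch_posP hx.
  rewrite -map_mxcompress; apply/arch_posP => r r0.
  have uh : hermitian_mx (- mxcompress alpha (mou_unit_mx X m)).
    rewrite /hermitian_mx mxstarN mxstar_compress hermitian_mxdiag_const//.
    exact: mou_unit_hermitian.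
  have [k k0 pk] := mou_order_unit hX uh.
  have [a pa Ea] := hx _ (divr_gt0 r0 k0).
  exists (mxcompress alpha a + mxscale (r / k)%:C
    (mxscale k%:C (mou_unit_mx X n) - mxcompress alpha (mou_unit_mx X m))).
    apply: mou_posD; first exact: mou_compatible.
    by apply: mou_posZ => //; rewrite divr_ge0 ?ltW.
  rewrite map_mxD map_mxcompress Ea -map_mxcompress -map_mxD; congr (ppr _).
  rewrite mxcompressD mxcompressZ mxscaleDr mxscaleA -rmorphM mulfVK ?gt_eqF//.
  by rewrite mxscaleN addrC -addrA addrA subrKA addrC.
- move=> n q hq; have [x xh <-] := hermitian_lift hq.
  have [r r0 pr_] := mou_order_unit hX xh; exists r => //.
  by rewrite -arch_proj_mx_unit -map_mxscale -map_mxD; exact: arch_pos_proj.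
- move=> n q _; have [x <-] := arch_proj_mx_surj q => hx.
  apply/arch_posP => r r0; have r2 : 0 < r / 2 by rewrite divr_gt0.
  have := hx _ r2; rewrite -arch_proj_mx_unit -map_mxscale -map_mxD => /arch_posP/(_ _ r2)[p pp E].
  by exists p => //; rewrite E addrA -mxscaleDl -rmorphD -splitr.
Qed.

End MatrixOrderUnit.

(** * The spaces SOS(E) are operator systems *)

Section SumsOfSquares.
Variables (R : realType) (G : groupType) (A : groupCstar R G).
Local Notation C := R[i].
Local Notation d := (delta A).

Definition span_val_linear (D : posDomain G) : {linear spanS A D -> A} :=
  HB.pack (@span_val R G A D)
    (GRing.isLinear.Build C (spanS A D) A _ (@span_val R G A D)
      (fun a x y => erefl)).

Section Trace.
Variable tau : {scalar A}.
Hypothesis tau_delta : forall s, tau (d s) = (s == 1%g)%:R.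

(** A condition that is closed under sums and satisfied by all sums of
squares, and that forces a cone to be proper. *)
Definition trace_faithful (D : posDomain G) n (X : 'M[spanS A D]_n) : Prop :=
  0 <= \sum_i tau (span_val (X i i)) /\
  (\sum_i tau (span_val (X i i)) = 0 -> X = 0).

Lemma trace_faithful_cone (D : posDomain G) n : convex_cone (@trace_faithful D n).
Proof.
split.
- have t0 : \sum_i tau (span_val ((0 : 'M[spanS A D]_n) i i)) = 0.
    by apply: big1 => i _; rewrite mxE; exact: linear0.
  by split=> //; rewrite t0.
- move=> X Y [X0 X1] [Y0 Y1].
  have tD : \sum_i tau (span_val ((X + Y) i i)) =
      \sum_i tau (span_val (X i i)) + \sum_i tau (span_val (Y i i)).
    by rewrite -big_split; apply: eq_bigr => i _; rewrite mxE span_valD linearD.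
  rewrite /trace_faithful /= tD; split; first exact: addr_ge0.
  move=> /eqP; rewrite paddr_eq0// => /andP[/eqP/X1 -> /eqP/Y1 ->].
  by rewrite addr0.
- move=> r X r0 [X0 X1].
  have tZ : \sum_i tau (span_val (mxscale r%:C X i i)) =
      r%:C * \sum_i tau (span_val (X i i)).
    by rewrite mulr_sumr; apply: eq_bigr => i _; rewrite mxE span_valZ linearZ.
  rewrite /trace_faithful /= tZ; split; first by rewrite mulr_ge0// ler0c.
  move=> /eqP; rewrite mulf_eq0 => /orP[|/eqP/X1 ->]; last first.
    by apply/matrixP => i j; rewrite !mxE scaler0.
  by move=> /eqP [->]; apply/matrixP => i j; rewrite !mxE scale0r.
Qed.

Lemma trace_faithful_sos (D : posDomain G) n E (X : 'M[spanS A D]_n) :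
  sos_cone E (map_mx (@span_val _ _ _ _) X) -> trace_faithful X.
Proof.
move=> hX.
have tE : \sum_i tau (map_mx (@span_val _ _ _ _) X i i) =
    \sum_i tau (span_val (X i i)) by apply: eq_bigr => i _; rewrite mxE.
split; first by rewrite -tE; exact: sos_trace_ge0 hX.
rewrite -tE => /(sos_trace_eq0 tau_delta hX) /matrixP X0.
by apply/matrixP => i j; apply: val_inj; have := X0 i j; rewrite !mxE.
Qed.

Lemma trace_faithful_proper (D : posDomain G) n (X : 'M[spanS A D]_n) :
  trace_faithful X -> trace_faithful (- X) -> X = 0.
Proof.
move=> [X0 X1] [NX0 _]; apply: X1; apply: le_anti; rewrite X0 andbT -oppr_ge0.
move: NX0; congr (0 <= _); rewrite -sumrN; apply: eq_bigr => i _.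
by rewrite mxE -linearN.
Qed.

End Trace.

(** What SOS(E) and UOS_0(D) have in common: spanning cones and the order
unit come from the squares that the cones contain. *)
Lemma mou_of_sos (D : posDomain G) (K : forall n, set 'M[spanS A D]_n)
    (Kh : forall n x, K n x -> hermitian_mx x) :
  (forall n, convex_cone (K n)) ->
  (forall n x, K n x -> K n (- x) -> x = 0) ->
  (forall m n (alpha : 'M[C]_(n, m)) x, K m x -> K n (mxcompress alpha x)) ->
  (forall g, pd_set D g -> exists E, ratio_set E g /\
    forall n (X : 'M[spanS A D]_n), sos_cone E (map_mx (@span_val _ _ _ _) X) -> K n X) ->
  is_matrix_order_unit_space (MouData Kh (spanS_unit_hermitian A D)).
Proof.
move=> Kcone Kproper Kcomp Ksos.
have dom n (x : 'M[spanS A D]_n) : hermitian_mx x -> dominated (K n) x.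
  apply: order_unit_of_sos => // g /Ksos[E [Eg EK]]; exists E; split=> //.
  exact: EK.
split=> // n x /= hx.
have [r r0 hr] := dom n x hx.
have [s s0 hs] := dom n 0 (mxstar0 _ n n).
rewrite addr0 in hs; have [_ _ KZ] := Kcone n.
exists (mxscale r%:C (mxdiag_const n (spanS_unit A D)) + x),
  (mxscale r%:C (mxdiag_const n (spanS_unit A D))); split=> //.
  have -> : mxscale r%:C (mxdiag_const n (spanS_unit A D)) =
      mxscale (r / s)%:C (mxscale s%:C (mxdiag_const n (spanS_unit A D))).
    by rewrite mxscaleA -rmorphM mulfVK ?gt_eqF.
  by apply: KZ => //; rewrite divr_ge0// ltW.
by rewrite addrAC subrr add0r.
Qed.

Lemma SOS_mou (E : finNonempty G) : is_matrix_order_unit_space (SOS A E).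
Proof.
have [tau [tau_delta _]] := canonical_trace A.
apply: mou_of_sos.
- move=> n; split.
  + by rewrite /SOS_pos /= (map_mx0 (span_val_linear _)); exact: sos0.
  + by move=> x y; rewrite /SOS_pos /= (map_mxD (span_val_linear _)); exact: sos_add.
  + move=> r x r0 hx; rewrite /SOS_pos /= (map_mxscale (span_val_linear _)).
    exact: sos_scale.
- move=> n x hx hNx; apply: (trace_faithful_proper (tau := tau)).
    exact: trace_faithful_sos hx.
  exact: trace_faithful_sos hNx.
- move=> m n alpha x hx; rewrite /SOS_pos /= (map_mxcompress (span_val_linear _)).
  exact: sos_compress.
- by move=> g Eg; exists (val E).
Qed.

Lemma SOS_operator_system (E : finNonempty G) : is_operator_system (SOS A E).
Proof.
split; first exact: SOS_mou.
move=> n x hx hr; apply: sos_closed => [i j|r /hr].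
  by rewrite mxE; exact: span_valP.
rewrite /= /SOS_pos /= (map_mxD (span_val_linear _)) (map_mxscale (span_val_linear _)).
by rewrite (map_mxdiag_const (span_val_linear _)) /= delta1.
Qed.

End SumsOfSquares.

(** * The space UOS_0(Delta) and the diagram *)

Section Colimit.
Variables (R : realType) (G : groupType) (A : groupCstar R G) (D : posDomain G).
Local Notation C := R[i].
Local Notation d := (delta A).
Local Notation V := (spanS A D).
Implicit Types (E : S_family D).

Lemma pair_neq0 (g : G) : [fset 1%g; g]%fset != fset0.
Proof. by apply/fset0Pn; exists 1%g; rewrite !inE eqxx. Qed.

Definition pair_set (g : G) : finNonempty G :=
  exist (fun E : {fset G} => is_true (E != fset0)) _ (pair_neq0 g).

Lemma pair_ratio (g : G) : pd_set D g -> `[< ratio_domain (pair_set g) `<=` D >].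
Proof.
move=> Dg; apply/asboolP => h [s /= + [t /= + <-]].
rewrite !inE => /orP[]/eqP -> /orP[]/eqP ->;
  rewrite ?mulgV ?invg1 ?mulg1 ?mul1g //; [exact: pd_one | exact: posDomainV |exact: pd_one].
Qed.

Definition pair_index (g : G) (Dg : pd_set D g) : S_family D :=
  exist (fun E : finNonempty G => is_true `[< ratio_domain E `<=` D >]) _ (pair_ratio Dg).

Lemma pair_index_ratio g (Dg : pd_set D g) : pd_set (ratio_domain (val (pair_index Dg))) g.
Proof.
exists g; first by rewrite /= !inE eqxx orbT.
by exists 1%g; rewrite ?invg1 ?mulg1//= !inE eqxx.
Qed.

Lemma UOS0_cone n : convex_cone (@UOS0_pos R G A D n).
Proof.
split.
- by move=> B [[]].
- move=> x y hx hy B hB; have [[_ BD _] _] := hB.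
  by apply: BD; [exact: hx | exact: hy].
- move=> r x r0 hx B hB; have [[_ _ BZ] _] := hB.
  by apply: BZ => //; exact: hx.
Qed.

Lemma UOS0_pos_ind n (P : set 'M[V]_n) : convex_cone P ->
  (forall E x, sos_cone (val (val E)) (map_mx (@span_val _ _ _ _) x) -> P x) ->
  forall x, @UOS0_pos R G A D n x -> P x.
Proof. by move=> hP PE x; apply; split=> // y [E]; exact: PE. Qed.

Lemma UOS0_pos_sos n E (x : 'M[V]_n) :
  sos_cone (val (val E)) (map_mx (@span_val _ _ _ _) x) -> UOS0_pos x.
Proof. by move=> hx B [_]; apply; exists E. Qed.

Lemma UOS0_mou : is_matrix_order_unit_space (UOS0 A D).
Proof.
have [tau [tau_delta _]] := canonical_trace A.
apply: mou_of_sos.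
- exact: UOS0_cone.
- have tf n (x : 'M[V]_n) : UOS0_pos x -> trace_faithful tau x.
    apply: UOS0_pos_ind; first exact: trace_faithful_cone.
    by move=> E y; exact: trace_faithful_sos.
  by move=> n x /tf hx /tf hNx; exact: trace_faithful_proper hx hNx.
- move=> m n alpha x; move: x; apply: UOS0_pos_ind.
    have [K0 KD KZ] := UOS0_cone n; split.
    + rewrite /= (_ : mxcompress alpha 0 = 0)//; apply/matrixP => i j; rewrite !mxE.
      by rewrite big1// => k _; rewrite big1// => l _; rewrite mxE scaler0.
    + by move=> x y hx hy; rewrite /= mxcompressD; exact: KD.
    + by move=> r x r0 hx; rewrite /= mxcompressZ; exact: KZ.
  move=> E x hx; apply: (@UOS0_pos_sos _ E).
  by rewrite (map_mxcompress (span_val_linear _ _)); exact: sos_compress.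
- move=> g Dg; exists (val (val (pair_index Dg))); split.
    exact: pair_index_ratio.
  by move=> n X hX; exact: (@UOS0_pos_sos _ (pair_index Dg)).
Qed.

(** If E1 h is contained in E2, then E1 E1^-1 = (E1 h) (E1 h)^-1 is contained
in E2 E2^-1, and squares over E1 are squares over E2. *)
Lemma S_le_translate E1 E2 h :
  (forall s, s \in val (val E1) -> (s * h)%g \in val (val E2)) ->
  S_le A E1 E2.
Proof.
move=> Eh.
have sub : ratio_domain (val E1) `<=` ratio_domain (val E2).
  move=> _ [s sE [t tE <-]]; exists (s * h)%g; first exact: Eh.
  exists (t * h)%g; first exact: Eh.
  by rewrite invgM mulgA mulgK.
exists sub; split.
- by move=> a x y; exact: val_inj.
- exact: val_inj.
- move=> n x hx; rewrite /= /SOS_pos /= -map_mx_comp.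
  exact: sos_translate Eh hx.
Qed.

Lemma SOS_diagram : is_opsys_diagram (@SOS_incl R G A D).
Proof.
split.
- split=> [E|E1 E2 E3 h12 h23].
    by apply: (@S_le_translate _ _ 1%g) => s; rewrite mulg1.
  case: (h12) (h23) => s12 [l12 u12 p12] [s23 [l23 u23 p23]].
  exists (subset_trans s12 s23); split.
  + by move=> a x y; exact: val_inj.
  + exact: val_inj.
  + move=> n x /p12 /p23; rewrite -map_mx_comp; congr mou_pos.
    by apply/matrixP => i j; rewrite !mxE; exact: val_inj.
- by move=> E; exact: SOS_operator_system.
- move=> E1 E2 h; case: (h) => s [l u p]; split.
  + by move=> a x y; exact: val_inj.
  + exact: val_inj.
  + move=> n x /p; congr mou_pos; apply/matrixP => i j; rewrite !mxE; exact: val_inj.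
- by move=> E h x; exact: val_inj.
- by move=> *; exact: val_inj.
Qed.

(** For a combination b over {1, g}, x |-> tau(b x star b) / tau(b star b) is
a state, as (b y) star (b y) is again of the form (star a) a.  So if all
states vanish on x, the form tau(b x star b) vanishes for all such b, and by
polarization so does tau(delta_1 x delta_g^-1), the coefficient of x at g. *)
Lemma UOS0_null0 (x : UOS0 A D) : x \in null_pred (X := UOS0 A D) -> x = 0.
Proof.
have [tau [tau_delta tau_pos]] := canonical_trace A.
move=> /null_predP hx; apply: val_inj.
have /span_predP /fourier_eq0 := span_valP x.
apply; first exact: tau_delta.
move=> g.
pose P := [fset 1%g; g]%fset.
pose ext (w : P -> C) s : C := if insub s is Some s' then w s' else 0.
have extE (w : P -> C) s : ext w (fsval s) = w s by rewrite /ext valK.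
have vec (w : P -> C) : tau (lincomb A P (ext w) * span_val x * star (lincomb A P (ext w))) = 0.
  set b := lincomb A P (ext w).
  have [b0|b0] := eqVneq (tau (b * star b)) 0.
    have -> : b = 0; last by rewrite !mul0r linear0.
    exact: tau_lincomb_eq0.
  have bp : 0 < tau (b * star b) by rewrite lt_def b0 tau_lincomb_ge0.
  have [F FE] : exists F : {scalar UOS0 A D},
      forall y : V, F y = tau (b * span_val y * star b) / tau (b * star b).
    pose f (y : UOS0 A D) : C := tau (b * span_val y * star b) / tau (b * star b).
    have f_lin : scalar f.
      move=> a y z; rewrite /f mulrDr mulrDl linearD /= -scalerAr -scalerAl linearZ /=.
      by rewrite mulrDl mulrA.
    pose F : {scalar UOS0 A D} := HB.pack f (GRing.isLinear.Build C (UOS0 A D) C _ f f_lin).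
    by exists F.
  have /hx : is_state F.
    split; first by rewrite FE /= delta1 mulr1 divff.
    move=> y hy; have -> : F y = F ((const_mx y : 'M[UOS0 A D]_1) 0 0) by rewrite mxE.
    move: (const_mx y) hy; apply: UOS0_pos_ind; first split.
    - by rewrite /= mxE raddf0.
    - by move=> y1 y2 h1 h2; rewrite /= mxE raddfD addr_ge0.
    - by move=> r y1 r0 h1; rewrite /= mxE linearZ mulr_ge0// ler0c.
    - move=> E y1 /sos_coneP[K [v /(_ 0 0)]]; rewrite mxE /= FE => ->.
      rewrite mulr_sumr mulr_suml linear_sum.
      apply: divr_ge0; last exact: ltW.
      apply: sumr_ge0 => k _.
      have := tau_pos (star (b * lincomb A (val (val E)) (v k 0))).
      by rewrite starK starM !mulrA.
  by rewrite FE => /eqP; rewrite mulf_eq0 invr_eq0 (negPf b0) orbF => /eqP.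
have P1 : 1%g \in P by rewrite !inE eqxx.
have Pg : g \in P by rewrite !inE eqxx orbT.
have := sesqui_form_eq0 (F := fun s t : P =>
  tau (d (fsval s) * span_val x * star (d (fsval t)))) _ [` P1]%fset [` Pg]%fset.
rewrite /= delta1 mul1r star_delta; apply=> w.
rewrite -[RHS](vec w) /lincomb star_sum !mulr_suml linear_sum big_seq_fsetE.
apply: eq_bigr => s _; rewrite mulr_sumr linear_sum big_seq_fsetE.
apply: eq_bigr => t _; rewrite !extE starZ -!scalerAl -scalerAr !linearZ /=.
exact: mulrCA.
Qed.

End Colimit.

(** * Linear maps on S[Delta] *)

Section LinearExtension.
Variables (R : realType) (G : groupType) (A : groupCstar R G).
Local Notation C := R[i].
Local Notation d := (delta A).

(** The sum cannot be moved inside h directly, since its terms are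
elements of C^*(G) that lie in S[D] only by hypothesis; hence the induction,
which peels off one term of x at a time. *)
Lemma span_linear_comb (D : posDomain G) (W : lmodType C) (h : spanS A D -> W)
    (c : G -> W) (l : seq (C * G)) (x : spanS A D) :
  linear h -> (forall g (Dg : pd_set D g), h (SpanS (delta_span A Dg)) = c g) ->
  (forall p, p \in l -> pd_set D p.2) ->
  span_val x = \sum_(p <- l) p.1 *: d p.2 -> h x = \sum_(p <- l) p.1 *: c p.2.
Proof.
move=> hl hc; elim: l x => [|[a g] l IH] x lD xE.
  have -> : x = 0 by apply: val_inj; rewrite /= xE big_nil.
  have h00 := hl 1 0 0; rewrite !scale1r addr0 in h00.
  by rewrite big_nil; apply: (addrI (h 0)); rewrite addr0 -h00.
have Dg : pd_set D g by apply: (lD (a, g)); exact: mem_head.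
pose dg := SpanS (delta_span A Dg).
rewrite -[x](subrKC (a *: dg)) hl hc big_cons; congr (_ + _).
apply: IH => [p pl|]; first by apply: lD; rewrite inE pl orbT.
by rewrite /= xE big_cons addrC addKr.
Qed.

(** Send x to the combination of the c(g) given by a chosen representation
of x; by linear independence any other representation has the same value,
which makes the map linear. *)
Lemma span_extension (D : posDomain G) (W : lmodType C) (c : G -> W) :
  exists2 h : spanS A D -> W, linear h &
    forall g (Dg : pd_set D g), h (SpanS (delta_span A Dg)) = c g.
Proof.
have [tau [tau_delta _]] := canonical_trace A.
have /choice[L hL] (x : spanS A D) : exists l : seq (C * G),
    span_val x = \sum_(p <- l) p.1 *: d p.2.
  by have /span_predP[l _ lE] := span_valP x; exists l.
pose h x := \sum_(p <- L x) p.1 *: c p.2.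
have hE x l : span_val x = \sum_(p <- l) p.1 *: d p.2 ->
    h x = \sum_(p <- l) p.1 *: c p.2.
  move=> xl; apply/eqP; rewrite -subr_eq0; apply/eqP.
  pose l' := L x ++ [seq (- p.1, p.2) | p <- l].
  have diffE (U : lmodType C) (b : G -> U) : \sum_(p <- l') p.1 *: b p.2 =
      \sum_(p <- L x) p.1 *: b p.2 - \sum_(p <- l) p.1 *: b p.2.
    rewrite big_cat big_map /= -sumrN; congr (_ + _).
    by apply: eq_bigr => p _; rewrite scaleNr.
  rewrite -diffE; apply: (delta_independent tau_delta).
  by rewrite diffE -hL -xl subrr.
exists h => [a x y|g Dg].
  rewrite (hE _ ([seq (a * p.1, p.2) | p <- L x] ++ L y)).
    rewrite big_cat big_map /= scaler_sumr; congr (_ + _).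
    by apply: eq_bigr => p _; rewrite scalerA.
  rewrite /= big_cat big_map /= -hL; congr (_ + _).
  by rewrite hL scaler_sumr; apply: eq_bigr => p _; rewrite scalerA.
by rewrite (hE _ [:: (1, g)]) ?big_seq1 ?scale1r.
Qed.

Lemma span_linear_eq (D : posDomain G) (W : lmodType C) (h k : spanS A D -> W) :
  linear h -> linear k ->
  (forall g (Dg : pd_set D g),
    h (SpanS (delta_span A Dg)) = k (SpanS (delta_span A Dg))) -> h =1 k.
Proof.
move=> hl kl hk x; have /span_predP[l lD xE] := span_valP x.
pose c g := if pselect (pd_set D g) is left Dg then k (SpanS (delta_span A Dg)) else 0.
have cE g (Dg : pd_set D g) : k (SpanS (delta_span A Dg)) = c g.
  rewrite /c; case: pselect => // Dg'; congr k; exact: val_inj.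
rewrite (span_linear_comb hl (fun g Dg => etrans (hk g Dg) (cE g Dg)) lD xE).
by rewrite (span_linear_comb kl cE lD xE).
Qed.

End LinearExtension.

(** * The universal property *)

Section UniversalProperty.
Variables (R : realType) (G : groupType) (A : groupCstar R G) (D : posDomain G).
Local Notation C := R[i].
Local Notation d := (delta A).
Local Notation V := (spanS A D).
Local Notation pr := (@arch_proj R (UOS0 A D)).

Lemma arch_proj_inj : injective pr.
Proof. by move=> x y /arch_projP/UOS0_null0/eqP; rewrite subr_eq0 => /eqP. Qed.

Lemma SOS_to_UOS_cocone :
  is_opsys_cocone (@SOS_incl R G A D) (Y := UOS A D) (@SOS_to_UOS R G A D).
Proof.
split.
- by apply: arch_operator_system; exact: UOS0_mou.
- move=> E; split.
  + by move=> a x y; rewrite /SOS_to_UOS -linearP; congr pr; exact: val_inj.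
  + by rewrite /SOS_to_UOS /=; congr pr; exact: val_inj.
  + move=> n x hx.
    have -> : map_mx (@SOS_to_UOS R G A D E) x =
        map_mx pr (map_mx (span_incl (@S_familyP _ _ E)) x) by rewrite -map_mx_comp.
    apply: (arch_pos_proj (@UOS0_mou _ _ A D)); apply: (@UOS0_pos_sos _ _ _ _ _ E).
    by rewrite -map_mx_comp.
- by move=> E1 E2 h x; rewrite /SOS_to_UOS; congr pr; exact: val_inj.
Qed.

Variables (Y : mouData R) (psi : forall E : S_family D, SOS_family A E -> Y).
Hypothesis psiP : is_opsys_cocone (@SOS_incl R G A D) psi.

Definition cocone_value (g : G) : Y :=
  if pselect (pd_set D g) is left Dg then
    psi (SpanS (delta_span A (pair_index_ratio Dg)) : SOS_family A (pair_index Dg))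
  else 0.

(** With g = s t^-1, translation by t maps {1, g} to {t, s}, a subset of E;
compatibility along this arrow of the diagram gives the equality. *)
Lemma cocone_value_delta (E : S_family D) g (Eg : pd_set (ratio_domain (val E)) g) :
  psi (SpanS (delta_span A Eg) : SOS_family A E) = cocone_value g.
Proof.
have [_ _ comp] := psiP.
rewrite /cocone_value; case: pselect => [Dg|]; last by case; exact: (S_familyP Eg).
have [s sE [t tE stg]] := Eg.
have le : S_le A (pair_index Dg) E.
  apply: (@S_le_translate _ _ _ _ _ _ t) => u.
  by rewrite /= !inE => /orP[]/eqP ->; rewrite ?mul1g // -stg mulgVK.
by rewrite -(comp _ _ le); congr psi; exact: val_inj.
Qed.

Variable h : V -> Y.
Hypothesis h_linear : linear h.
Hypothesis h_delta : forall g (Dg : pd_set D g),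
  h (SpanS (delta_span A Dg)) = cocone_value g.

Lemma extension_SOS E (x : SOS_family A E) : h (span_incl (@S_familyP _ _ E) x) = psi x.
Proof.
have [_ /(_ E)[psi_lin _ _] _] := psiP.
apply: (span_linear_eq (h := h \o span_incl (@S_familyP _ _ E)) (k := @psi E)) => //.
  move=> a y z /=; rewrite -h_linear; congr h; exact: val_inj.
move=> g Eg /=; rewrite cocone_value_delta.
rewrite -(h_delta (S_familyP Eg)); congr h; exact: val_inj.
Qed.

Lemma extension_unit : h (spanS_unit A D) = mou_unit Y.
Proof.
have [_ /(_ (pair_index (pd_one D)))[_ u _] _] := psiP.
by rewrite -u /= -extension_SOS; congr h; exact: val_inj.
Qed.

Definition extension_map : {linear V -> Y} := HB.pack h (GRing.isLinear.Build C V Y _ h h_linear).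

(** The matrices sent to the cone of Y form a convex cone, so it is enough
to consider a sum of squares over some E; this is the image of a positive
matrix of SOS(E), on which h agrees with the leg at E. *)
Lemma extension_pos n (x : 'M[UOS0 A D]_n) : mou_pos x -> mou_pos (map_mx h x).
Proof.
have [[Ymou _] psi_ucp _] := psiP.
move: x; apply: UOS0_pos_ind; first split.
- by rewrite /= (map_mx0 extension_map); have [] := mou_cone Ymou n.
- by move=> x y hx hy; rewrite /= (map_mxD extension_map); exact: mou_posD.
- by move=> r x r0 hx; rewrite /= (map_mxscale extension_map); exact: mou_posZ.
move=> E x xE.
pose x' : 'M[SOS_family A E]_n := \matrix_(i, j) SpanS (sos_span (E := val E) i j xE).
have -> : map_mx h x = map_mx (@psi E) x'.
  apply/matrixP => i j; rewrite !mxE -extension_SOS; congr h; apply: val_inj.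
  by rewrite /= mxE.
have [_ _ ppos] := psi_ucp E; apply: ppos; rewrite /= /SOS_pos /=.
suff -> : map_mx (@span_val _ _ _ _) x' = map_mx (@span_val _ _ _ _) x by exact: xE.
by apply/matrixP => i j; rewrite !mxE /= mxE.
Qed.

(** As the quotient map is injective, r + x itself is in the cone of
UOS_0(Delta) for all r > 0; so r + h(x) is positive, and Y is Archimedean. *)
Lemma extension_arch_pos n (x : 'M[UOS0 A D]_n) :
  mou_pos (map_mx pr x : 'M[UOS A D]_n) -> mou_pos (map_mx h x).
Proof.
have [[Ymou Yarch] _ _] := psiP.
move=> /arch_posP hx.
have hr (r : R) : 0 < r -> mou_pos (mxscale r%:C (mou_unit_mx Y n) + map_mx h x).
  move=> /hx[p pp E].
  have -> : mxscale r%:C (mou_unit_mx Y n) + map_mx h x = map_mx h p.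
    have -> : p = mxscale r%:C (mou_unit_mx (UOS0 A D) n) + x.
      apply/matrixP => i j; have /matrixP/(_ i j) := E; rewrite !mxE.
      exact: arch_proj_inj.
    rewrite (map_mxD extension_map) (map_mxscale extension_map); congr (mxscale _ _ + _).
    by rewrite (map_mxdiag_const extension_map) /= extension_unit.
  exact: extension_pos.
apply: Yarch => //.
have := mou_pos_hermitian (hr 1 ltr01).
rewrite /hermitian_mx mxstarD mxstarZr hermitian_mxdiag_const ?mou_unit_hermitian//.
exact: addrI.
Qed.

End UniversalProperty.

Theorem theorem5p11 (R : realType) (Gamma : groupType)
  (CstarGamma : groupCstar R Gamma) (Delta : posDomain Gamma) :
  is_opsys_diagram (@SOS_incl R Gamma CstarGamma Delta) /\
  is_opsys_colimit (@SOS_incl R Gamma CstarGamma Delta)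
    (L := UOS CstarGamma Delta) (@SOS_to_UOS R Gamma CstarGamma Delta).
Proof.
split; first exact: SOS_diagram.
split; first exact: SOS_to_UOS_cocone.
move=> Y psi psiP.
have [h h_linear h_delta] := @span_extension _ _ CstarGamma Delta _ (cocone_value psi).
pose pr := @arch_proj R (UOS0 CstarGamma Delta).
pose f (q : UOS CstarGamma Delta) : Y := h (repr q).
have fE x : f (pr x) = h x by congr h; apply: arch_proj_inj; exact: arch_proj_repr.
exists f; split.
  split; last by move=> E x; rewrite fE (extension_SOS psiP h_linear h_delta).
  split.
  - move=> a p q; rewrite -(arch_proj_repr p) -(arch_proj_repr q) -linearP.
    by rewrite !fE h_linear.
  - by rewrite fE (extension_unit psiP h_linear h_delta).
  - move=> n q; have [x <-] := arch_proj_mx_surj q.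
    move=> /(extension_arch_pos psiP h_linear h_delta); congr mou_pos.
    by apply/matrixP => i j; rewrite !mxE fE.
move=> f' [[f'_linear _ _] f'_psi]; apply/funext => q.
rewrite -(arch_proj_repr q) fE.
apply: (span_linear_eq (k := f' \o pr)) => // [a x y|g Dg]; first by rewrite /= /pr linearP f'_linear.
rewrite h_delta /= -(cocone_value_delta psiP (pair_index_ratio Dg)) -f'_psi.
by congr (f' (pr _)); exact: val_inj.
Qed.
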